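(* Let $\overline{S}_0,\overline{S}_1,\dots$ be a sequence of bounded martingales on $2^{<\omega}$ (with no effectivity assumption) such that $\lim_{n\to\infty}\overline{S}_n(\bot)=0$, and let $T\subseteq 2^{<\omega}$ be a homogeneous tree that has no computable infinite path. Then there exists a martingale $S$ such that $S\ge\overline{S}_n$ (pointwise on $2^{<\omega}$) for infinitely many $n$, and $S$ does not compute an infinite path through $T$.
   Context: A martingale on $2^{<\omega}$ is a function $S:2^{<\omega}\to\mathbb{R}^{\ge 0}$ with $2S(\rho)=S(\rho0)+S(\rho1)$ for all $\rho$; $\bot$ is the empty string. A function is bounded if its range is a bounded subset of $\mathbb{R}$. A tree $T\subseteq 2^{<\omega}$ is homogeneous if there are sets $B_0,B_1,\dots\subseteq\{0,1\}$ such that $\rho\in T$ iff $\rho(n)\in B_n$ for all $n<|\rho|$. Computation from a martingale $S$ is via an oracle coding, for every $\rho$, a representation of the real $S(\rho)$ (e.g. an integer part together with an infinite binary expansion). *)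

(* Defs.v *)
From Stdlib Require Import Reals List Arith ZArith.
Import ListNotations.
Open Scope R_scope.

Definition martingale (S : list bool -> R) : Prop :=
  (forall rho, 0 <= S rho) /\
  (forall rho, 2 * S rho = S (rho ++ [false]) + S (rho ++ [true])).

Definition bounded_fun (S : list bool -> R) : Prop :=
  exists M : R, forall rho, Rabs (S rho) <= M.

Definition homogeneous (T : list bool -> Prop) : Prop :=
  exists B : nat -> bool -> Prop,
    forall rho, T rho <-> (forall n, (n < length rho)%nat -> B n (nth n rho false)).

Definition prefix (X : nat -> bool) (n : nat) : list bool := map X (seq 0 n).

Definition is_path (T : list bool -> Prop) (X : nat -> bool) : Prop :=
  forall n, T (prefix X n).

Inductive prog : Type :=
| PZero : prog
| PSucc : prog
| PProj : nat -> prog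
| POracle : prog
| PComp : prog -> list prog -> prog
| PRec : prog -> prog -> prog
| PMu : prog -> prog.

Inductive eval (O : nat -> nat -> nat) : prog -> list nat -> nat -> Prop :=
| eZero : forall args, eval O PZero args 0
| eSucc : forall args, eval O PSucc args (S (hd 0%nat args))
| eProj : forall i args, eval O (PProj i) args (nth i args 0%nat)
| eOracle : forall args,
    eval O POracle args (O (nth 0 args 0%nat) (nth 1 args 0%nat))
| eComp : forall f gs args ys y,
    evalL O gs args ys -> eval O f ys y -> eval O (PComp f gs) args y
| eRec0 : forall g h args y,
    eval O g args y -> eval O (PRec g h) (0%nat :: args) y
| eRecS : forall g h n args r y,
    eval O (PRec g h) (n :: args) r -> eval O h (n :: r :: args) y ->
    eval O (PRec g h) (S n :: args) y
| eMu : forall f args n,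
    eval O f (n :: args) 0%nat ->
    (forall m, (m < n)%nat -> exists k, eval O f (m :: args) (S k)) ->
    eval O (PMu f) args n
with evalL (O : nat -> nat -> nat) : list prog -> list nat -> list nat -> Prop :=
| eNil : forall args, evalL O [] args []
| eCons : forall g gs args y ys,
    eval O g args y -> evalL O gs args ys -> evalL O (g :: gs) args (y :: ys).

Definition computes (O : nat -> nat -> nat) (X : nat -> bool) : Prop :=
  exists p : prog, forall n, eval O p [n] (if X n then 1%nat else 0%nat).

Definition computable (X : nat -> bool) : Prop := computes (fun _ _ => 0%nat) X.

(* Computable bijection nat -> list bool:
   0 |-> [], 2m+1 |-> false :: decode m, 2m+2 |-> true :: decode m. *)
Fixpoint decode_aux (fuel n : nat) : list bool :=
  match fuel with
  | O => []
  | S f => match n with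
           | O => []
           | S m => (if Nat.even m then false else true) :: decode_aux f (Nat.div2 m)
           end
  end.
Definition decode_str (n : nat) : list bool := decode_aux n n.

(* Canonical oracle coding of a nonnegative-valued function on strings:
   query (a, 0) = integer part of S(decode a);
   query (a, k+1) = k-th binary digit after the point of S(decode a)
   (the expansion not ending in all 1s). *)
Definition oracle_of (M : list bool -> R) : nat -> nat -> nat :=
  fun a k =>
    let x := M (decode_str a) in
    match k with
    | O => Z.to_nat (Int_part x)
    | S j => Nat.modulo (Z.to_nat (Int_part (x * 2 ^ (Datatypes.S j)))) 2
    end.

Definition computes_path_from (M : list bool -> R) (T : list bool -> Prop) : Prop :=
  exists X : nat -> bool, is_path T X /\ computes (oracle_of M) X.

(* Main.v *)
Require Import Defs.
From Stdlib Require Import Reals List Arith ZArith.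
From Stdlib Require Import Lia Lra Classical ClassicalEpsilon Cantor.
Import ListNotations.
Open Scope R_scope.

(** Forcing with conditions (m, F, M): F is a martingale, constant above level m and with values in
    multiples of 4^-m, and M is a bounded martingale below F on level m.  The condition promises
    that S agrees with F up to level m and stays above M; small martingales of the sequence can be
    added to M at any time.

    To defeat a program p, use that a bounded martingale converges in L2 to write M <= G + H with G
    a finite dyadic martingale and H a bounded martingale of tiny initial value.  Call (n, i)
    covered if every bounded martingale N of tiny initial value admits a finite extension F' >= G + N
    of F on which p outputs i at input n; by compactness this is a Sigma_1 property.
    - If (n, i) is covered and i is not allowed by T at n, apply this to N = H and pass to F'.
    - If neither (n, 0) nor (n, 1) is covered, with counterexamples N_0 and N_1, replace M by
      G + H + N_0 + N_1; then p cannot output 0 or 1 at n.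
    - Otherwise searching for a covered (n, i) computes a path through T. *)

(** * Recursive functions *)

Section Recursive.
Local Open Scope nat_scope.

(** The obstacle is that M carries no effectivity, so a search for extensions of F above M would not
    be computable. Splitting off G isolates what has to be known exactly: G has finitely many
    values, which can be hardwired, while of H only a bound and the smallness of the initial value
    are retained. The search then ranges over a whole compact class containing H and no longer
    mentions M. To make this class finitely branching, its members are coded by integer-valued
    supermartingales: rounding destroys the martingale equation but can be arranged to keep an
    inequality. The grid makes finite information about S exact: values that are multiples of 4^-m
    determine every oracle answer about their strings, so an output of p is witnessed by a finite
    extension. Homogeneity enters because a sequence is a path iff each bit is allowed at its own
    position. Hence one disallowed output defeats a program, and bits found by separate searches for
    different n fit together into a path. *)

Definition recursive (k : nat) (f : list nat -> nat) : Prop :=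
  exists p, forall e, length e = k -> eval (fun _ _ => 0) p e (f e).

Lemma recursive_ext k f g :
  (forall e, length e = k -> f e = g e) -> recursive k f -> recursive k g.
Proof.
  intros H [p Hp]. exists p. intros e He. rewrite <- H by assumption. auto.
Qed.

Lemma evalL_proj O e l :
  evalL O (map PProj l) e (map (fun i => nth i e 0) l).
Proof. induction l; simpl; constructor; auto. constructor. Qed.

Lemma map_nth_seq (e : list nat) : map (fun i => nth i e 0) (seq 0 (length e)) = e.
Proof.
  induction e as [|x e IH]; simpl; auto.
  f_equal. rewrite <- seq_shift, map_map. exact IH.
Qed.

Lemma nth_tl (e : list nat) i : nth i (tl e) 0 = nth (S i) e 0.
Proof. destruct e; simpl; auto. destruct i; auto. Qed.

Lemma recursive_tl k f : recursive k f -> recursive (S k) (fun e => f (tl e)).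
Proof.
  intros [p Hp]. exists (PComp p (map PProj (seq 1 k))). intros e He.
  eapply eComp; [apply evalL_proj|].
  destruct e as [|x e]; simpl in *; [discriminate|].
  rewrite <- seq_shift, map_map. injection He as He. subst k.
  simpl. rewrite map_nth_seq. auto.
Qed.

(** Each recursion or bounded quantifier puts a new variable at the head of the environment, so
    outer variables appear under a tower of [tl]. [tails] describes these towers by their syntax,
    which lets the tactics below recognise a variable without computing its index. *)
Inductive tails : (list nat -> list nat) -> Prop :=
| tails_id : tails (fun e => e)
| tails_tl w : tails w -> tails (fun e => tl (w e)).

Lemma tails_shift w : tails w -> exists j, forall i e, nth i (w e) 0 = nth (j + i) e 0.
Proof.
  induction 1 as [|w _ [j Hj]].
  - exists 0. auto.
  - exists (S j). intros i e. rewrite nth_tl, Hj. f_equal. lia.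
Qed.

Lemma recursive_var k i w : tails w -> recursive k (fun e => nth i (w e) 0).
Proof.
  intros [j Hj]%tails_shift. exists (PProj (j + i)). intros e _. rewrite Hj. constructor.
Qed.

Lemma recursive_comp k k' f gs :
  recursive k' f -> Forall (recursive k) gs -> length gs = k' ->
  recursive k (fun e => f (map (fun g => g e) gs)).
Proof.
  intros [p Hp] Hgs Hl.
  assert (exists ps, forall e, length e = k ->
            evalL (fun _ _ => 0) ps e (map (fun g => g e) gs)) as [ps Hps].
  { clear Hl. induction Hgs as [|g gs [q Hq] _ [qs Hqs]].
    - exists []. intros. constructor.
    - exists (q :: qs). intros. simpl. constructor; auto. }
  exists (PComp p ps). intros e He. eapply eComp; [apply Hps; auto|].
  apply Hp. rewrite length_map. auto.
Qed.

Lemma recursive_fun1 k (f : nat -> nat) x :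
  recursive 1 (fun e => f (nth 0 e 0)) -> recursive k x -> recursive k (fun e => f (x e)).
Proof.
  intros Hf Hx. apply (recursive_comp k 1 (fun e => f (nth 0 e 0)) [x]); auto.
Qed.

Lemma recursive_S k x : recursive k x -> recursive k (fun e => S (x e)).
Proof.
  apply recursive_fun1. exists PSucc. intros [|y e] _; apply eSucc.
Qed.

Lemma recursive_const k c : recursive k (fun _ => c).
Proof.
  induction c as [|c IH]; [exists PZero; intros; constructor | apply recursive_S; auto].
Qed.

Lemma recursive_nat_rect k g h t :
  recursive k g ->
  recursive (S (S k)) (fun e => h (tl (tl e)) (nth 0 e 0) (nth 1 e 0)) ->
  recursive k t ->
  recursive k (fun e => nat_rect (fun _ => nat) (g e) (fun n r => h e n r) (t e)).
Proof.
  intros [pg Hg] [ph Hh] [pt Ht].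
  exists (PComp (PRec pg ph) (pt :: map PProj (seq 0 k))). intros e He.
  apply eComp with (ys := t e :: e).
  - constructor; auto. rewrite <- (map_nth_seq e) at 2. rewrite He. apply evalL_proj.
  - induction (t e) as [|n IH]; simpl; [apply eRec0; auto|].
    eapply eRecS; [exact IH|].
    apply (Hh (n :: _ :: e)). simpl. auto.
Qed.

Lemma recursive_mu k f :
  recursive (S k) f -> (forall e, length e = k -> exists u, f (u :: e) = 0) ->
  exists g, recursive k g /\ forall e, length e = k -> f (g e :: e) = 0.
Proof.
  intros [p Hp] Hex.
  assert (forall e, exists u, length e = k -> f (u :: e) = 0 /\ forall v, v < u -> f (v :: e) <> 0)
    as Hmin.
  { intros e. destruct (Nat.eq_dec (length e) k) as [He|He]; [|exists 0; tauto].
    destruct (Hex e He) as [u Hu]. clear Hex.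
    induction u as [u IH] using lt_wf_ind.
    destruct (classic (exists v, v < u /\ f (v :: e) = 0)) as [(v & Hv & Hv')|Hn].
    - apply (IH v); auto.
    - exists u. intros _. split; auto. intros v Hv Hv'. apply Hn. eauto. }
  destruct (choice _ Hmin) as [g Hg]. exists g. split.
  - exists (PMu p). intros e He. destruct (Hg e He) as [H0 H1]. apply eMu.
    + pose proof (Hp (g e :: e) (f_equal S He)) as Hge. rewrite H0 in Hge. exact Hge.
    + intros v Hv. exists (pred (f (v :: e))). specialize (H1 v Hv).
      replace (S (pred (f (v :: e)))) with (f (v :: e)) by lia. apply Hp. simpl; auto.
  - intros e He. apply Hg; auto.
Qed.

Ltac rec_basic :=
  match goal with
  | |- recursive _ (fun _ => ?c) => apply recursive_const
  | |- recursive _ (fun e => nth _ _ 0) => apply recursive_var; repeat constructor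
  | |- recursive _ (fun e => S _) => apply recursive_S
  | H : recursive ?k ?f |- recursive ?k ?f => exact H
  end.

Lemma recursive_pred k x : recursive k x -> recursive k (fun e => pred (x e)).
Proof.
  apply recursive_fun1.
  apply recursive_ext with
    (f := fun e => nat_rect (fun _ => nat) 0 (fun n _ => n) (nth 0 e 0)).
  - intros e _. destruct (nth 0 e 0); auto.
  - apply (@recursive_nat_rect 1 (fun _ => 0) (fun _ n _ => n)); repeat rec_basic.
Qed.

Lemma recursive_add k x y :
  recursive k x -> recursive k y -> recursive k (fun e => x e + y e).
Proof.
  intros Hx Hy.
  apply recursive_ext with (f := fun e => nat_rect (fun _ => nat) (y e) (fun _ r => S r) (x e)).
  - intros e _. induction (x e); simpl; auto.
  - apply (@recursive_nat_rect k y (fun _ _ r => S r)); repeat rec_basic.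
Qed.

Lemma recursive_sub k x y :
  recursive k x -> recursive k y -> recursive k (fun e => x e - y e).
Proof.
  intros Hx Hy.
  apply recursive_ext with (f := fun e => nat_rect (fun _ => nat) (x e) (fun _ r => pred r) (y e)).
  - intros e _. induction (y e); simpl; lia.
  - apply (@recursive_nat_rect k x (fun _ _ r => pred r)); repeat rec_basic.
    apply recursive_pred. rec_basic.
Qed.

Lemma recursive_mul k x y :
  recursive k x -> recursive k y -> recursive k (fun e => x e * y e).
Proof.
  intros Hx Hy.
  apply recursive_ext with (f := fun e => nat_rect (fun _ => nat) 0 (fun _ r => y e + r) (x e)).
  - intros e _. induction (x e); simpl; auto.
  - apply (@recursive_nat_rect k (fun _ => 0) (fun e _ r => y e + r)); repeat rec_basic.
    apply recursive_add; [|rec_basic].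
    apply (@recursive_tl (S k) (fun e => y (tl e))), recursive_tl; auto.
Qed.

Lemma recursive_pow k x y :
  recursive k x -> recursive k y -> recursive k (fun e => x e ^ y e).
Proof.
  intros Hx Hy.
  apply recursive_ext with (f := fun e => nat_rect (fun _ => nat) 1 (fun _ r => x e * r) (y e)).
  - intros e _. induction (y e); simpl; auto.
  - apply (@recursive_nat_rect k (fun _ => 1) (fun e _ r => x e * r)); repeat rec_basic.
    apply recursive_mul; [|rec_basic].
    apply (@recursive_tl (S k) (fun e => x (tl e))), recursive_tl; auto.
Qed.

Lemma recursive_if_eq0 k x y z :
  recursive k x -> recursive k y -> recursive k z ->
  recursive k (fun e => if x e =? 0 then y e else z e).
Proof.
  intros Hx Hy Hz.
  apply recursive_ext with (f := fun e => (1 - x e) * y e + (1 - (1 - x e)) * z e).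
  - intros e _. destruct (x e); simpl; lia.
  - repeat first [rec_basic | apply recursive_add | apply recursive_mul | apply recursive_sub].
Qed.

Lemma recursive_if_ltb k x x' y z :
  recursive k x -> recursive k x' -> recursive k y -> recursive k z ->
  recursive k (fun e => if x e <? x' e then y e else z e).
Proof.
  intros Hx Hx' Hy Hz.
  apply recursive_ext with (f := fun e => if S (x e) - x' e =? 0 then y e else z e).
  - intros e _. destruct (Nat.eqb_spec (S (x e) - x' e) 0), (Nat.ltb_spec (x e) (x' e)); auto; lia.
  - apply recursive_if_eq0; auto. apply recursive_sub; repeat rec_basic.
Qed.

(** The quotient is the number of n < x with (n + 1) y <= x, and counting is primitive recursion. *)
Lemma recursive_div k x y :
  recursive k x -> recursive k y -> (forall e, y e <> 0) ->
  recursive k (fun e => x e / y e).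
Proof.
  intros Hx Hy H0.
  apply recursive_ext with (f := fun e => nat_rect (fun _ => nat) 0
    (fun n r => r + if x e <? S n * y e then 0 else 1) (x e)).
  - intros e _. specialize (H0 e).
    assert (forall n, nat_rect (fun _ => nat) 0
      (fun n r => r + if x e <? S n * y e then 0 else 1) n = min n (x e / y e)) as ->.
    { induction n as [|n IH]; [reflexivity|]. cbn [nat_rect]. rewrite IH.
      pose proof (Nat.div_mod (x e) (y e) H0). pose proof (Nat.mod_upper_bound (x e) (y e) H0).
      set (d := x e / y e) in *.
      destruct (Nat.ltb_spec (x e) (S n * y e)).
      - assert (d < S n) by nia. lia.
      - assert (S n < S d) by nia. lia. }
    apply Nat.min_r. apply Nat.Div0.div_le_upper_bound. nia.
  - apply (@recursive_nat_rect k (fun _ => 0)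
      (fun e n r => r + if x e <? S n * y e then 0 else 1)); repeat rec_basic.
    assert (forall z, recursive k z -> recursive (S (S k)) (fun e => z (tl (tl e)))) as Hw.
    { intros z Hz. apply (@recursive_tl (S k) (fun e => z (tl e))), recursive_tl; auto. }
    apply recursive_add; [rec_basic|].
    apply recursive_if_ltb; try rec_basic; auto.
    apply recursive_mul; repeat rec_basic; auto.
Qed.

Lemma recursive_mod k x y :
  recursive k x -> recursive k y -> (forall e, y e <> 0) ->
  recursive k (fun e => x e mod y e).
Proof.
  intros Hx Hy H0.
  apply recursive_ext with (f := fun e => x e - y e * (x e / y e)).
  - intros e _. pose proof (Nat.div_mod (x e) (y e) (H0 e)). lia.
  - apply recursive_sub; auto. apply recursive_mul; auto. apply recursive_div; auto.
Qed.

(** * Decidable relations and bounded quantifiers *)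

Definition chi (P : Prop) : nat := if excluded_middle_informative P then 1 else 0.

Lemma chi_true P : P -> chi P = 1.
Proof. intros H. unfold chi. destruct excluded_middle_informative; tauto. Qed.

Lemma chi_false P : ~ P -> chi P = 0.
Proof. intros H. unfold chi. destruct excluded_middle_informative; tauto. Qed.

(** Relations remain propositions, with excluded middle supplying the characteristic function;
    decidability is expressed only here. Search predicates can then be written with ordinary
    connectives and bounded quantifiers and shown decidable by following their syntax. *)
Definition recursive_rel (k : nat) (P : list nat -> Prop) : Prop :=
  recursive k (fun e => chi (P e)).

Lemma recursive_rel_ext k P Q :
  (forall e, length e = k -> (P e <-> Q e)) -> recursive_rel k P -> recursive_rel k Q.
Proof.
  intros H. apply recursive_ext. intros e He. specialize (H e He).
  unfold chi. repeat destruct excluded_middle_informative; tauto.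
Qed.

Lemma recursive_rel_le k x y :
  recursive k x -> recursive k y -> recursive_rel k (fun e => x e <= y e).
Proof.
  intros Hx Hy. apply recursive_ext with (f := fun e => 1 - (x e - y e)).
  - intros e _. unfold chi. destruct excluded_middle_informative; lia.
  - repeat first [rec_basic | apply recursive_sub].
Qed.

Lemma recursive_rel_not k P : recursive_rel k P -> recursive_rel k (fun e => ~ P e).
Proof.
  intros HP. apply recursive_ext with (f := fun e => 1 - chi (P e)).
  - intros e _. unfold chi. repeat destruct excluded_middle_informative; tauto.
  - apply recursive_sub; auto. rec_basic.
Qed.

Lemma recursive_rel_and k P Q :
  recursive_rel k P -> recursive_rel k Q -> recursive_rel k (fun e => P e /\ Q e).
Proof.
  intros HP HQ. apply recursive_ext with (f := fun e => chi (P e) * chi (Q e)).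
  - intros e _. unfold chi. repeat destruct excluded_middle_informative; tauto.
  - apply recursive_mul; auto.
Qed.

Lemma recursive_rel_or k P Q :
  recursive_rel k P -> recursive_rel k Q -> recursive_rel k (fun e => P e \/ Q e).
Proof.
  intros HP HQ. apply recursive_rel_ext with (P := fun e => ~ (~ P e /\ ~ Q e)).
  - intros; tauto.
  - auto using recursive_rel_not, recursive_rel_and.
Qed.

Lemma recursive_rel_imp k P Q :
  recursive_rel k P -> recursive_rel k Q -> recursive_rel k (fun e => P e -> Q e).
Proof.
  intros HP HQ. apply recursive_rel_ext with (P := fun e => ~ (P e /\ ~ Q e)).
  - intros; tauto.
  - auto using recursive_rel_not, recursive_rel_and.
Qed.

Lemma recursive_rel_eq k x y :
  recursive k x -> recursive k y -> recursive_rel k (fun e => x e = y e).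
Proof.
  intros Hx Hy. apply recursive_rel_ext with (P := fun e => x e <= y e /\ y e <= x e).
  - intros; lia.
  - auto using recursive_rel_le, recursive_rel_and.
Qed.

Lemma recursive_rel_forall k t P :
  recursive k t -> recursive_rel (S k) (fun e => P (tl e) (nth 0 e 0)) ->
  recursive_rel k (fun e => forall x, x < t e -> P e x).
Proof.
  intros Ht HP.
  apply recursive_ext with
    (f := fun e => nat_rect (fun _ => nat) 1 (fun n r => chi (P e n) * r) (t e)).
  - intros e _. induction (t e) as [|n IH]; cbn [nat_rect].
    + rewrite chi_true; auto. intros; lia.
    + rewrite IH. symmetry. destruct (classic (P e n)) as [Hn|Hn].
      * rewrite (chi_true (P e n)) by auto. rewrite Nat.mul_1_l.
        unfold chi. destruct excluded_middle_informative as [H1|H1],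
          excluded_middle_informative as [H2|H2]; auto; exfalso; [apply H2 | apply H1];
          intros x Hx; [|destruct (Nat.eq_dec x n); [subst; auto|]]; auto with arith.
        apply H2. lia.
      * rewrite (chi_false (P e n)), chi_false by auto. auto.
  - apply (@recursive_nat_rect k (fun _ => 1) (fun e n r => chi (P e n) * r)); repeat rec_basic.
    apply recursive_mul; [|rec_basic].
    (* The recursion step sees the counter and the accumulator ahead of e, while P expects only the
       counter; composition with projections drops the accumulator. *)
    apply recursive_ext with
      (f := fun e => (fun e' => chi (P (tl e') (nth 0 e' 0)))
                       (map (fun g => g e) ((fun e => nth 0 e 0) ::
                          map (fun i => fun e => nth (S (S i)) e 0) (seq 0 k)))).
    + intros e He. cbn [map tl nth]. do 2 f_equal. rewrite map_map.
      destruct e as [|a [|b e]]; try discriminate. simpl in *.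
      injection He as <-. apply map_nth_seq.
    + apply (recursive_comp (S (S k)) (S k) (fun e' => chi (P (tl e') (nth 0 e' 0)))); auto.
      * constructor; [apply recursive_var; constructor|].
        apply Forall_map, Forall_forall. intros. apply recursive_var. constructor.
      * simpl. rewrite length_map, length_seq. auto.
Qed.

Lemma recursive_rel_exists k t P :
  recursive k t -> recursive_rel (S k) (fun e => P (tl e) (nth 0 e 0)) ->
  recursive_rel k (fun e => exists x, x < t e /\ P e x).
Proof.
  intros Ht HP.
  apply recursive_rel_ext with (P := fun e => ~ forall x, x < t e -> ~ P e x).
  - intros e _. split.
    + intros H. apply NNPP. intros Hn. apply H. intros x Hx Hp. apply Hn. eauto.
    + intros (x & Hx & Hp) H. exact (H x Hx Hp).
  - apply recursive_rel_not, recursive_rel_forall; auto. apply recursive_rel_not. auto.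
Qed.

End Recursive.

(** * Bounded evaluation of oracle programs *)

Section Evaluation.
Local Open Scope nat_scope.

Lemma prog_nested_ind (P : prog -> Prop) :
  P PZero -> P PSucc -> (forall i, P (PProj i)) -> P POracle ->
  (forall f gs, P f -> Forall P gs -> P (PComp f gs)) ->
  (forall g h, P g -> P h -> P (PRec g h)) ->
  (forall f, P f -> P (PMu f)) ->
  forall p, P p.
Proof.
  intros HZ HS HP HO HC HR HM. fix IH 1.
  intros [| | i | | f gs | g h | f]; [exact HZ|exact HS|apply HP|exact HO|..].
  - apply HC; [apply IH|]. induction gs; constructor; [apply IH|assumption].
  - apply HR; apply IH.
  - apply HM; apply IH.
Qed.

Fixpoint decode_prog (fuel n : nat) : prog :=
  match fuel with
  | 0 => PZero
  | S fuel =>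
    let (t, r) := of_nat n in
    let (x, y) := of_nat r in
    match t with
    | 0 => PZero
    | 1 => PSucc
    | 2 => PProj r
    | 3 => POracle
    | 4 => PComp (decode_prog fuel x)
             (let (len, z) := of_nat y in
              nat_rect (fun _ => nat -> list prog) (fun _ => [])
                (fun _ rec z => let (a, b) := of_nat z in decode_prog fuel a :: rec b) len z)
    | 5 => PRec (decode_prog fuel x) (decode_prog fuel y)
    | _ => PMu (decode_prog fuel r)
    end
  end.

(** The claim covers every sufficiently large fuel, so that subprograms of different depths can be
    decoded with a common one. *)
Lemma decode_prog_surj p : exists d, forall fuel, d <= fuel -> exists n, decode_prog fuel n = p.
Proof.
  induction p as [ | |i| |f gs [df IHf] IHgs|g h [dg IHg] [dh IHh]|f [df IHf]] using prog_nested_ind.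
  1-4: exists 1; intros [|fuel] Hf; [lia|].
  - exists (to_nat (0, 0)). cbn [decode_prog]. rewrite cancel_of_to. destruct (of_nat 0); auto.
  - exists (to_nat (1, 0)). cbn [decode_prog]. rewrite cancel_of_to. destruct (of_nat 0); auto.
  - exists (to_nat (2, i)). cbn [decode_prog]. rewrite cancel_of_to. destruct (of_nat i); auto.
  - exists (to_nat (3, 0)). cbn [decode_prog]. rewrite cancel_of_to. destruct (of_nat 0); auto.
  - assert (exists d, forall fuel, d <= fuel -> exists z,
      nat_rect (fun _ => nat -> list prog) (fun _ => [])
        (fun _ rec z => let (a, b) := of_nat z in decode_prog fuel a :: rec b) (length gs) z = gs)
      as [d Hd].
    { clear IHf. induction IHgs as [|g gs [d1 H1] _ [d2 H2]].
      - exists 0. intros. exists 0. auto.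
      - exists (d1 + d2). intros fuel Hf.
        destruct (H1 fuel) as [n1 E1]; [lia|]. destruct (H2 fuel) as [n2 E2]; [lia|].
        exists (to_nat (n1, n2)). cbn [length nat_rect].
        rewrite cancel_of_to, E1. f_equal. exact E2. }
    exists (S (df + d)). intros [|fuel] Hf; [lia|].
    destruct (IHf fuel) as [x Hx]; [lia|]. destruct (Hd fuel) as [z Hz]; [lia|].
    exists (to_nat (4, to_nat (x, to_nat (length gs, z)))).
    cbn [decode_prog]. rewrite !cancel_of_to, Hx, Hz. auto.
  - exists (S (dg + dh)). intros [|fuel] Hf; [lia|].
    destruct (IHg fuel) as [x Hx]; [lia|]. destruct (IHh fuel) as [y Hy]; [lia|].
    exists (to_nat (5, to_nat (x, y))). cbn [decode_prog]. rewrite !cancel_of_to, Hx, Hy. auto.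
  - exists (S df). intros [|fuel] Hf; [lia|]. destruct (IHf fuel) as [x Hx]; [lia|].
    exists (to_nat (6, x)). cbn [decode_prog]. rewrite cancel_of_to, Hx. destruct (of_nat x); auto.
Qed.

Lemma prog_countable : exists enum : nat -> prog, forall p, exists n, enum n = p.
Proof.
  exists (fun k => let (fuel, n) := of_nat k in decode_prog fuel n). intros p.
  destruct (decode_prog_surj p) as [d Hd]. destruct (Hd d (le_n d)) as [n Hn].
  exists (to_nat (d, n)). rewrite cancel_of_to. auto.
Qed.

Lemma eval_functional O p args y y' : eval O p args y -> eval O p args y' -> y = y'.
Proof.
  revert args y y'.
  induction p as [ | |i| |f gs IHf IHgs|g h IHg IHh|f IHf] using prog_nested_ind;
    intros args y y' H H'.
  1-4: inversion H; inversion H'; subst; auto.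
  - inversion H as [| | | |? ? ? ys ? Hys Hy| | |]; subst.
    inversion H' as [| | | |? ? ? ys' ? Hys' Hy'| | |]; subst.
    assert (ys = ys') as <-; [|eauto].
    clear H H' Hy Hy' IHf. revert ys ys' Hys Hys'.
    induction IHgs; intros ys ys' E E'; inversion E; inversion E'; subst; f_equal; eauto.
  - destruct args as [|n args]; [inversion H|].
    revert y y' H H'. induction n as [|n IHn]; intros y y' H H'.
    + inversion H; inversion H'; subst; eauto.
    + inversion H as [| | | | | |? ? ? ? r ? Hr Hy|]; subst.
      inversion H' as [| | | | | |? ? ? ? r' ? Hr' Hy'|]; subst.
      rewrite (IHn _ _ Hr Hr') in Hy. eauto.
  - inversion H as [| | | | | | |? ? ? H0 H1]; subst.
    inversion H' as [| | | | | | |? ? ? H0' H1']; subst.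
    destruct (lt_eq_lt_dec y y') as [[Hlt|Heq]|Hlt]; auto.
    + destruct (H1' y Hlt) as [k Hk]. specialize (IHf _ _ _ H0 Hk). discriminate.
    + destruct (H1 y' Hlt) as [k Hk]. specialize (IHf _ _ _ H0' Hk). discriminate.
Qed.

(* Results encode options: 0 is "no value", [S y] is the value y.  The oracle [q] is partial in
   the same sense, and [s] bounds the length of unbounded searches. *)
Fixpoint ev (q : nat -> nat -> nat) (s : nat) (p : prog) (args : list nat) : nat :=
  match p with
  | PZero => 1
  | PSucc => S (S (nth 0 args 0))
  | PProj i => S (nth i args 0)
  | POracle => q (nth 0 args 0) (nth 1 args 0)
  | PComp f gs =>
    let vs := map (fun g => ev q s g args) gs in
    if fold_right Nat.mul 1 vs =? 0 then 0 else ev q s f (map pred vs)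
  | PRec g h =>
    match args with
    | [] => 0
    | n :: r => nat_rect (fun _ => nat) (ev q s g r)
                  (fun i v => if v =? 0 then 0 else ev q s h (i :: pred v :: r)) n
    end
  | PMu f =>
    (* search state: 0 = still searching, 1 = failed, n + 2 = found n *)
    pred (nat_rect (fun _ => nat) 0
            (fun n r => if r =? 0 then
                          (if ev q s f (n :: args) =? 0 then 1
                           else if pred (ev q s f (n :: args)) =? 0 then S (S n) else 0)
                        else r) s)
  end.

(** The values v are encoded options: 1 is a defined zero and anything from 2 on is a defined
    nonzero value, so the search may pass beyond m exactly when 2 <= v m. *)
Lemma mu_search_spec (v : nat -> nat) s :
  let st := nat_rect (fun _ => nat) 0
              (fun n r => if r =? 0 then
                            (if v n =? 0 then 1 else if pred (v n) =? 0 then S (S n) else 0)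
                          else r) s in
  (st = 0 -> forall m, m < s -> 2 <= v m) /\
  (forall n, st = S (S n) -> v n = 1 /\ forall m, m < n -> 2 <= v m).
Proof.
  induction s as [|s IH]; cbn [nat_rect] in *; [split; intros; lia|].
  set (st := nat_rect _ _ _ s) in *.
  cbn zeta in *. destruct IH as [IH0 IH1].
  destruct (Nat.eqb_spec st 0) as [E|E].
  - destruct (Nat.eqb_spec (v s) 0), (Nat.eqb_spec (pred (v s)) 0).
    + split; intros; lia.
    + split; intros; lia.
    + split; [lia|]. intros n' [= <-]. split; [lia|auto].
    + split; [|lia]. intros _ m Hm.
      destruct (Nat.eq_dec m s) as [->|]; [lia|]. apply IH0; [auto|lia].
  - split; [lia|auto].
Qed.

Lemma mu_search_found (v : nat -> nat) n s :
  n < s -> v n = 1 -> (forall m, m < n -> 2 <= v m) ->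
  nat_rect (fun _ => nat) 0
              (fun n r => if r =? 0 then
                            (if v n =? 0 then 1 else if pred (v n) =? 0 then S (S n) else 0)
                          else r) s = S (S n).
Proof.
  intros Hs Hn Hm. induction s as [|s IH]; [lia|]. cbn [nat_rect].
  destruct (Nat.eq_dec n s) as [->|Hne].
  - replace (nat_rect _ _ _ s) with 0.
    + rewrite Hn. auto.
    + symmetry. clear - Hm. induction s as [|s IH]; auto. cbn [nat_rect].
      rewrite IH by (intros; apply Hm; lia). specialize (Hm s ltac:(lia)).
      destruct (Nat.eqb_spec (v s) 0); [lia|]. destruct (Nat.eqb_spec (pred (v s)) 0); [lia|auto].
  - rewrite IH by lia. auto.
Qed.

Lemma ev_sound q O s p args y :
  (forall a j v, q a j = S v -> O a j = v) -> ev q s p args = S y -> eval O p args y.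
Proof.
  intros Hq. revert args y.
  induction p as [ | |i| |f gs IHf IHgs|g h IHg IHh|f IHf] using prog_nested_ind;
    intros args y H; cbn [ev] in H.
  - injection H as <-. constructor.
  - injection H as <-. destruct args; apply eSucc.
  - injection H as <-. constructor.
  - apply Hq in H. rewrite <- H. constructor.
  - cbn zeta in H. destruct (Nat.eqb_spec (fold_right Nat.mul 1 (map (fun g => ev q s g args) gs)) 0)
      as [|Hp]; [discriminate|].
    eapply eComp; [|apply IHf, H]. clear H IHf.
    induction IHgs as [|g gs Hg _ IH]; simpl in *; constructor.
    + apply Hg. lia.
    + apply IH. intros E. rewrite E in Hp. lia.
  - destruct args as [|n args]; [discriminate|].
    revert y H. induction n as [|n IHn]; cbn [nat_rect]; intros y H; [apply eRec0; auto|].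
    match type of H with (if ?r =? 0 then _ else _) = _ => set (w := r) in * end.
    destruct (Nat.eqb_spec w 0); [discriminate|].
    eapply eRecS; [apply IHn with (y := pred w); lia|]. auto.
  - pose proof (mu_search_spec (fun n => ev q s f (n :: args)) s) as [_ H1].
    cbn zeta beta in H1. destruct (H1 y) as [Hy Hlt]; [lia|].
    apply eMu; auto. intros m Hm. specialize (Hlt m Hm).
    exists (ev q s f (m :: args) - 2). apply IHf. lia.
Qed.

(** A halting computation makes finitely many queries and searches. Only the string code a of a
    query is bounded by u, not the digit position j: the finite oracles used later know values
    exactly and hence all their digits. *)
Lemma ev_complete O p args y :
  eval O p args y ->
  exists u, forall q s, u <= s -> (forall a j, a < u -> q a j = S (O a j)) -> ev q s p args = S y.
Proof.
  revert args y.
  induction p as [ | |i| |f gs IHf IHgs|g h IHg IHh|f IHf] using prog_nested_ind;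
    intros args y H.
  - inversion H. exists 0. auto.
  - inversion H. exists 0. intros. destruct args; auto.
  - inversion H. exists 0. auto.
  - inversion H; subst. exists (S (nth 0 args 0)). intros q s _ Hq. simpl. apply Hq. lia.
  - inversion H as [| | | |? ? ? ys ? Hys Hy| | |]; subst.
    destruct (IHf _ _ Hy) as [u1 H1].
    assert (exists u, forall q s, u <= s -> (forall a j, a < u -> q a j = S (O a j)) ->
      map (fun g => ev q s g args) gs = map S ys) as [u2 H2].
    { clear - Hys IHgs. revert ys Hys. induction IHgs as [|g gs Hg _ IH]; intros ys Hys.
      - inversion Hys. exists 0. auto.
      - inversion Hys as [|? ? ? z zs Hz Hzs]; subst.
        destruct (Hg _ _ Hz) as [u1 H1]. destruct (IH _ Hzs) as [u2 H2].
        exists (u1 + u2). intros q s Hs Hq. simpl. f_equal.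
        + apply H1; [lia|]. intros; apply Hq; lia.
        + apply H2; [lia|]. intros; apply Hq; lia. }
    exists (u1 + u2). intros q s Hs Hq. cbn [ev]. cbn zeta.
    rewrite H2 by (try lia; intros; apply Hq; lia).
    rewrite map_map. simpl. rewrite map_id.
    destruct (Nat.eqb_spec (fold_right Nat.mul 1 (map S ys)) 0) as [E|_].
    + exfalso. clear - E. induction ys; simpl in *; lia.
    + apply H1; [lia|]. intros; apply Hq; lia.
  - destruct args as [|n args]; [inversion H|].
    revert y H. induction n as [|n IHn]; intros y H.
    + inversion H; subst. destruct (IHg args y) as [u Hu]; auto. exists u. auto.
    + inversion H as [| | | | | |? ? ? ? r ? Hr Hy|]; subst.
      destruct (IHn _ Hr) as [u1 H1]. destruct (IHh _ _ Hy) as [u2 H2].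
      exists (u1 + u2). intros q s Hs Hq.
      specialize (H1 q s ltac:(lia) ltac:(intros; apply Hq; lia)).
      specialize (H2 q s ltac:(lia) ltac:(intros; apply Hq; lia)).
      cbn [ev nat_rect] in *. rewrite H1. simpl. exact H2.
  - inversion H as [| | | | | | |? ? ? H0 H1]; subst.
    destruct (IHf _ _ H0) as [u0 E0].
    assert (exists u, forall q s, u <= s -> (forall a j, a < u -> q a j = S (O a j)) ->
      forall m, m < y -> 2 <= ev q s f (m :: args)) as [u1 E1].
    { clear H H0 E0. induction y as [|y IHy]; [exists 0; intros; lia|].
      destruct IHy as [u1 E1]; [intros; apply H1; lia|].
      destruct (H1 y) as [k Hk]; [lia|]. destruct (IHf _ _ Hk) as [u2 E2].
      exists (u1 + u2). intros q s Hs Hq m Hm. destruct (Nat.eq_dec m y) as [->|].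
      - rewrite E2; [lia|lia|]. intros; apply Hq; lia.
      - apply E1; [lia| |lia]. intros; apply Hq; lia. }
    exists (u0 + u1 + S y). intros q s Hs Hq. cbn [ev].
    rewrite (mu_search_found (fun n => ev q s f (n :: args)) y); auto; [lia| |].
    + apply E0; [lia|]. intros; apply Hq; lia.
    + apply E1; [lia|]. intros; apply Hq; lia.
Qed.

(** The program is fixed, so induction on it replaces a universal machine. The arguments are a list
    of recursive functions rather than one function into lists, so that recursion and minimization
    can add their own in front. The parameters c, b, m of the oracle stand for a code of finite
    data. *)
Lemma ev_recursive (q : nat -> nat -> nat -> nat -> nat -> nat)
  (Hq : forall k c b m a j, recursive k c -> recursive k b -> recursive k m ->
        recursive k a -> recursive k j -> recursive k (fun e => q (c e) (b e) (m e) (a e) (j e))) p :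
  forall k c b m s args,
    recursive k c -> recursive k b -> recursive k m -> recursive k s -> Forall (recursive k) args ->
    recursive k (fun e => ev (q (c e) (b e) (m e)) (s e) p (map (fun a => a e) args)).
Proof.
  induction p as [ | |i| |f gs IHf IHgs|g h IHg IHh|f IHf] using prog_nested_ind;
    intros k c b m s args Hc Hb Hm Hs Hargs.
  all: assert (Hnth : forall i, recursive k (fun e => nth i (map (fun a => a e) args) 0)) by
    (induction Hargs as [|a args Ha _ IH]; intros [|j]; simpl; auto using recursive_const).
  - cbn [ev]. apply recursive_const.
  - cbn [ev]. auto using recursive_S.
  - cbn [ev]. auto using recursive_S.
  - cbn [ev]. auto.
  - cbn [ev]. cbn zeta. apply recursive_if_eq0; [|apply recursive_const|].
    + clear IHf. induction IHgs; simpl; [apply recursive_const|]. apply recursive_mul; auto.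
    + apply recursive_ext with (f := fun e => ev (q (c e) (b e) (m e)) (s e) f
        (map (fun a => a e)
           (map (fun g e => pred (ev (q (c e) (b e) (m e)) (s e) g (map (fun a => a e) args))) gs))).
      * intros. rewrite !map_map. auto.
      * apply IHf; auto. apply Forall_map. eapply Forall_impl; [|exact IHgs].
        intros g Hg. apply recursive_pred. auto.
  - destruct Hargs as [|t args Ht Hargs]; cbn [ev map]; [apply recursive_const|].
    apply (recursive_nat_rect k
      (fun e => ev (q (c e) (b e) (m e)) (s e) g (map (fun a => a e) args))
      (fun e i v => if v =? 0 then 0 else
         ev (q (c e) (b e) (m e)) (s e) h (i :: pred v :: map (fun a => a e) args))); auto.
    apply recursive_if_eq0; [apply recursive_var; constructor|apply recursive_const|].
    assert (Hw : forall z, recursive k z -> recursive (S (S k)) (fun e => z (tl (tl e)))).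
    { intros z Hz. apply (recursive_tl (S k) (fun e => z (tl e))), recursive_tl; auto. }
    apply recursive_ext with (f := fun e => ev (q (c (tl (tl e))) (b (tl (tl e))) (m (tl (tl e))))
       (s (tl (tl e))) h (map (fun a => a e) ((fun e => nth 0 e 0) :: (fun e => pred (nth 1 e 0))
           :: map (fun a e => a (tl (tl e))) args))).
    + intros e _. simpl. rewrite map_map. auto.
    + apply IHh; auto. repeat constructor.
      * apply recursive_var; constructor.
      * apply recursive_pred, recursive_var; constructor.
      * apply Forall_map. eapply Forall_impl; [|exact Hargs]. auto.
  - cbn [ev]. apply recursive_pred.
    assert (Hw : forall z, recursive k z -> recursive (S (S k)) (fun e => z (tl (tl e)))).
    { intros z Hz. apply (recursive_tl (S k) (fun e => z (tl e))), recursive_tl; auto. }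
    apply (recursive_nat_rect k (fun _ => 0)
      (fun e n r => if r =? 0 then
         (if ev (q (c e) (b e) (m e)) (s e) f (n :: map (fun a => a e) args) =? 0 then 1
          else if pred (ev (q (c e) (b e) (m e)) (s e) f (n :: map (fun a => a e) args)) =? 0
          then S (S n) else 0) else r)); auto using recursive_const.
    assert (recursive (S (S k)) (fun e => ev (q (c (tl (tl e))) (b (tl (tl e))) (m (tl (tl e))))
       (s (tl (tl e))) f (nth 0 e 0 :: map (fun a => a (tl (tl e))) args))).
    { apply recursive_ext with (f := fun e => ev (q (c (tl (tl e))) (b (tl (tl e))) (m (tl (tl e))))
       (s (tl (tl e))) f (map (fun a => a e) ((fun e => nth 0 e 0)
           :: map (fun a e => a (tl (tl e))) args))).
      - intros e _. simpl. rewrite map_map. auto.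
      - apply IHf; auto. constructor.
        + apply recursive_var; constructor.
        + apply Forall_map. eapply Forall_impl; [|exact Hargs]. auto. }
    repeat first [assumption | apply recursive_if_eq0 | apply recursive_pred | apply recursive_const
      | apply recursive_S | apply recursive_var; constructor].
Qed.

End Evaluation.

(** * Compactness for finitely branching families *)

Section Compactness.
Local Open Scope nat_scope.

(** A prefix is kept when it extends to a solution at every stage. Its next value has finitely many
    choices, and one of them keeps this property. Since [P u] sees only the first [d u] values, the
    limit of the kept prefixes satisfies it. *)
Lemma konig (P : nat -> (nat -> nat) -> Prop) (bound : nat -> nat) (d : nat -> nat) :
  (forall u f, P (S u) f -> P u f) ->
  (forall u f g, (forall k, k < d u -> f k = g k) -> P u f -> P u g) ->
  (forall u f, P u f -> forall k, k <= u -> f k <= bound k) ->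
  (forall u, exists f, P u f) ->
  exists f, forall u, P u f.
Proof.
  intros Hdec Hfin Hb Hex.
  assert (Hmono : forall u v f, u <= v -> P v f -> P u f) by (induction 1; auto).
  set (good := fun s => forall u, exists f, map f (seq 0 (length s)) = s /\ P u f).
  assert (Hgood : forall s, good s -> exists v, good (s ++ [v])).
  { intros s Hs. apply NNPP. intros Hn.
    assert (Hv : forall v, exists u, forall f,
      map f (seq 0 (length (s ++ [v]))) = s ++ [v] -> ~ P u f).
    { intros v. apply NNPP. intros H. apply Hn. exists v. intros u. apply NNPP. intros H'.
      apply H. exists u. intros f Hf HP. apply H'. eauto. }
    destruct (choice _ Hv) as [U HU].
    (* Stage w is at least [length s], so that the bound on the next value is in force, and it is
       past the failure stage of each admissible value. *)
    assert (exists w, length s <= w /\ forall v, v <= bound (length s) -> U v <= w) as (w & Hw & HUw).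
    { clear. induction (bound (length s)) as [|b (w & Hw & IH)].
      - exists (length s + U 0). split; [lia|]. intros v Hv. replace v with 0 by lia. lia.
      - exists (w + U (S b)). split; [lia|]. intros v Hv.
        destruct (Nat.eq_dec v (S b)) as [->|]; [lia|]. specialize (IH v ltac:(lia)). lia. }
    destruct (Hs w) as (f & Hf & HP).
    apply (HU (f (length s)) f).
    - rewrite length_app, Nat.add_1_r, seq_S, map_app. simpl.
      rewrite Hf. auto.
    - apply Hmono with w; auto. apply HUw. apply (Hb w); auto. }
  assert (Hnext : forall s, exists v, good s -> good (s ++ [v])).
  { intros s. destruct (classic (good s)) as [H|H]; [|exists 0; tauto].
    destruct (Hgood s H) as [v Hv]. eauto. }
  destruct (choice _ Hnext) as [next Hn].
  set (pre := nat_rect (fun _ => list nat) [] (fun _ s => s ++ [next s])).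
  assert (Hlen : forall k, length (pre k) = k).
  { induction k; simpl; auto. rewrite length_app. simpl. lia. }
  assert (Hpre : forall k, good (pre k)).
  { induction k; [|simpl; auto]. intros u. destruct (Hex u) as [f Hf]. exists f. auto. }
  assert (Hmap : forall k, pre k = map (fun j => next (pre j)) (seq 0 k)).
  { induction k; auto. rewrite seq_S, map_app, <- IHk. auto. }
  exists (fun k => next (pre k)). intros u.
  destruct (Hpre (d u) u) as (f & Hf & HP).
  apply (Hfin u f); auto. intros k Hk.
  rewrite Hlen, Hmap in Hf.
  assert (forall j, j < d u -> nth j (map f (seq 0 (d u))) 0 = f j) as E1.
  { intros j Hj. rewrite nth_indep with (d' := f 0) by (rewrite length_map, length_seq; lia).
    rewrite map_nth, seq_nth; auto. }
  rewrite <- E1 by auto. rewrite Hf.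
  rewrite nth_indep with (d' := next (pre 0)) by (rewrite length_map, length_seq; lia).
  rewrite (map_nth (fun j => next (pre j))), seq_nth; auto.
Qed.

End Compactness.

(** * Codes of strings and of finite functions *)

Section Codes.
Local Open Scope nat_scope.

Fixpoint encode_str (rho : list bool) : nat :=
  match rho with
  | [] => 0
  | b :: r => S ((if b then 1 else 0) + 2 * encode_str r)
  end.

Lemma decode_aux_fuel f n : n <= f -> decode_aux f n = decode_str n.
Proof.
  unfold decode_str. revert f.
  induction n as [n IH] using lt_wf_ind. intros f Hf.
  destruct n as [|n]; destruct f as [|f]; try lia; auto. simpl. f_equal.
  pose proof (Nat.div2_odd n) as Hd.
  rewrite (IH (Nat.div2 n)) by lia. symmetry. apply IH; lia.
Qed.

Lemma decode_str_S n : decode_str (S n) = (if Nat.even n then false else true) :: decode_str (Nat.div2 n).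
Proof.
  unfold decode_str at 1. simpl. f_equal. apply decode_aux_fuel.
  pose proof (Nat.div2_odd n). lia.
Qed.

Lemma decode_encode rho : decode_str (encode_str rho) = rho.
Proof.
  induction rho as [|b r IH]; auto. cbn [encode_str]. rewrite decode_str_S.
  destruct b.
  - change (1 + 2 * encode_str r) with (S (2 * encode_str r)).
    rewrite Nat.div2_succ_double, IH.
    rewrite Nat.even_succ, <- Nat.negb_even, Nat.even_mul. auto.
  - change (0 + 2 * encode_str r) with (2 * encode_str r).
    rewrite Nat.div2_double, IH, Nat.even_mul. auto.
Qed.

Lemma encode_decode a : encode_str (decode_str a) = a.
Proof.
  induction a as [a IH] using lt_wf_ind. destruct a as [|a]; auto.
  rewrite decode_str_S. cbn [encode_str].
  pose proof (Nat.div2_odd a). rewrite IH by lia.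
  pose proof (Nat.div2_odd a) as E. rewrite <- Nat.negb_even in E.
  destruct (Nat.even a); simpl in *; lia.
Qed.

(** Level l is the interval of codes from 2^l - 1 to 2^(l+1) - 2, so quantifiers over a level of the
    tree become bounded quantifiers over numbers, as in [valid_grid] and [forcing]. *)
Lemma encode_bounds rho :
  2 ^ length rho <= S (encode_str rho) /\ encode_str rho < 2 ^ S (length rho) - 1.
Proof.
  induction rho as [|b r IH]; simpl in *; [lia|]. destruct b; lia.
Qed.

(** The head of a string is the least significant digit, so appending a bit adds 1 or 2 times 2^l.
    This is why the children of a code a on level l are written [a + 1 * 2 ^ l] and [a + 2 * 2 ^ l]
    below. *)
Lemma encode_snoc rho b :
  encode_str (rho ++ [b]) = encode_str rho + (if b then 2 else 1) * 2 ^ length rho.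
Proof.
  induction rho as [|c r IH]; [destruct b; auto|]. cbn [app encode_str length]. rewrite IH.
  rewrite Nat.pow_succ_r'. destruct b, c; lia.
Qed.

Lemma code_level l a :
  a < 2 ^ S l - 1 -> 2 ^ l <= S a -> exists rho, length rho = l /\ encode_str rho = a.
Proof.
  intros H1 H2. exists (decode_str a). split; [|apply encode_decode].
  pose proof (encode_bounds (decode_str a)) as [H3 H4]. rewrite encode_decode in *.
  assert (2 ^ S (length (decode_str a)) > 2 ^ l) by lia.
  assert (2 ^ S l > 2 ^ length (decode_str a)) by lia.
  apply Nat.pow_lt_mono_r_iff in H; [|lia]. apply Nat.pow_lt_mono_r_iff in H0; [|lia]. lia.
Qed.

Lemma code_bound l rho : length rho <= l -> encode_str rho < 2 ^ S l - 1.
Proof.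
  intros H. pose proof (encode_bounds rho) as [_ Hb].
  assert (2 ^ S (length rho) <= 2 ^ S l) by (apply Nat.pow_le_mono_r; lia). lia.
Qed.

Lemma code_length l a : a < 2 ^ S l - 1 -> length (decode_str a) <= l.
Proof.
  intros H. pose proof (encode_bounds (decode_str a)) as [H1 _]. rewrite encode_decode in H1.
  assert (2 ^ length (decode_str a) < 2 ^ S l) by lia.
  apply Nat.pow_lt_mono_r_iff in H0; lia.
Qed.

Lemma code_length_le a : length (decode_str a) <= a.
Proof.
  pose proof (encode_bounds (decode_str a)) as [H1 _]. rewrite encode_decode in H1.
  pose proof (Nat.pow_gt_lin_r 2 (length (decode_str a))). lia.
Qed.

(** A finite function with values at most b is coded by its expansion c in base b + 1. On L
    arguments it suffices to take c below (b + 1)^L, which makes quantifiers over finite functions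
    bounded. *)
Definition digit (c b a : nat) : nat := (c / S b ^ a) mod S b.

Lemma digit_surj b L : forall f, (forall a, a < L -> f a <= b) ->
  exists c, c < S b ^ L /\ forall a, a < L -> digit c b a = f a.
Proof.
  induction L as [|L IH]; intros f Hf; [exists 0; simpl; split; [lia|intros; lia]|].
  destruct (IH (fun a => f (S a))) as (c & Hc & Hd); [intros; apply Hf; lia|].
  pose proof (Hf 0 ltac:(lia)) as H0.
  exists (f 0 + c * S b). split; [rewrite Nat.pow_succ_r'; nia|].
  intros [|a] Ha; unfold digit in *.
  - rewrite Nat.pow_0_r, Nat.div_1_r, Nat.Div0.mod_add. apply Nat.mod_small. lia.
  - rewrite Nat.pow_succ_r', <- Nat.Div0.div_div, Nat.div_add by lia.
    rewrite (Nat.div_small (f 0)) by lia. apply Hd. lia.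
Qed.

(* The oracle answers of the function with values [digit c b a / 4 ^ m] on the strings of length
   at most [m], undefined (0) on longer strings. *)
Definition partial_oracle (c b m a j : nat) : nat :=
  if a <? 2 ^ S m - 1 then
    S (if j =? 0 then digit c b a / 4 ^ m else (digit c b a * 2 ^ j / 4 ^ m) mod 2)
  else 0.

Lemma recursive_digit k c b a :
  recursive k c -> recursive k b -> recursive k a -> recursive k (fun e => digit (c e) (b e) (a e)).
Proof.
  intros. unfold digit.
  apply recursive_mod; [apply recursive_div| |]; auto using recursive_S, recursive_pow.
  intros. apply Nat.pow_nonzero. lia.
Qed.

Ltac rec_step :=
  match goal with
  | H : recursive ?k ?f |- recursive ?k ?f => exact H
  | |- recursive _ (fun _ => ?c) => apply recursive_const
  | |- recursive _ (fun e => nth _ _ 0) => apply recursive_var; repeat constructor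
  | |- recursive _ (fun e => S _) => apply recursive_S
  | |- recursive _ (fun e => _ + _) => apply recursive_add
  | |- recursive _ (fun e => _ - _) => apply recursive_sub
  | |- recursive _ (fun e => _ * _) => apply recursive_mul
  | |- recursive _ (fun e => _ ^ _) => apply recursive_pow
  | |- recursive _ (fun e => _ / _) =>
    apply recursive_div; [| |intros; first [discriminate | apply Nat.pow_nonzero; discriminate]]
  | |- recursive _ (fun e => _ mod _) =>
    apply recursive_mod; [| |intros; first [discriminate | apply Nat.pow_nonzero; discriminate]]
  | |- recursive _ (fun e => if _ <? _ then _ else _) => apply recursive_if_ltb
  | |- recursive _ (fun e => if _ =? 0 then _ else _) => apply recursive_if_eq0
  | |- recursive _ (fun e => digit _ _ _) => apply recursive_digit
  end.

Lemma recursive_partial_oracle k c b m a j :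
  recursive k c -> recursive k b -> recursive k m -> recursive k a -> recursive k j ->
  recursive k (fun e => partial_oracle (c e) (b e) (m e) (a e) (j e)).
Proof.
  intros. unfold partial_oracle.
  repeat rec_step.
Qed.

Lemma recursive_ev k c b m s n p :
  recursive k c -> recursive k b -> recursive k m -> recursive k s -> recursive k n ->
  recursive k (fun e => ev (partial_oracle (c e) (b e) (m e)) (s e) p [n e]).
Proof.
  intros. apply (ev_recursive partial_oracle recursive_partial_oracle p k c b m s [n]); auto.
Qed.

(** A function of the first l letters is a finite case distinction with hardwired constants, hence
    recursive however the constants were obtained. This lets F and G, chosen without any
    effectivity, take part in a computable search. *)
Lemma recursive_step l : forall f : list bool -> nat,
  (forall rho, f (firstn l rho) = f rho) -> recursive 1 (fun e => f (decode_str (nth 0 e 0))).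
Proof.
  induction l as [|l IH]; intros f Hf.
  - apply recursive_ext with (f := fun _ => f []); [|apply recursive_const].
    intros e _. rewrite <- (Hf (decode_str _)). auto.
  - apply recursive_ext with (f := fun e => if nth 0 e 0 =? 0 then f [] else
      if pred (nth 0 e 0) mod 2 =? 0 then f (false :: decode_str (pred (nth 0 e 0) / 2))
      else f (true :: decode_str (pred (nth 0 e 0) / 2))).
    + intros e _. destruct (nth 0 e 0) as [|n]; auto. rewrite decode_str_S. simpl pred.
      rewrite Nat.div2_div. destruct (Nat.eqb_spec (n mod 2) 0) as [E|E].
      * apply Nat.Div0.mod_divides in E as [k ->]. rewrite Nat.even_mul. auto.
      * replace (Nat.even n) with false; auto. symmetry.
        apply Bool.not_true_iff_false. intros [k ->]%Nat.even_spec.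
        apply E. rewrite Nat.mul_comm. apply Nat.Div0.mod_mul.
    + assert (recursive 1 (fun e => pred (nth 0 e 0) / 2)) as Hd.
      { apply recursive_div; [|apply recursive_const|intros; lia].
        apply recursive_pred, recursive_var; constructor. }
      apply recursive_if_eq0; [apply recursive_var; constructor|apply recursive_const|].
      apply recursive_if_eq0.
      * apply recursive_mod; [|apply recursive_const|intros; lia].
        apply recursive_pred, recursive_var; constructor.
      * apply (recursive_fun1 1 (fun x => f (false :: decode_str x))); auto.
        apply (IH (fun r => f (false :: r))). intros r. apply (Hf (false :: r)).
      * apply (recursive_fun1 1 (fun x => f (true :: decode_str x))); auto.
        apply (IH (fun r => f (true :: r))). intros r. apply (Hf (true :: r)).
Qed.

(* [N] codes the supermartingale [N (code rho) / 4 ^ (length rho + t)] for a scale [t]. *)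
Definition valid_grid (C : nat) (N : nat -> nat) (u : nat) : Prop :=
  N 0 <= 3 /\
  (forall l, l < u -> forall a, a < 2 ^ S l - 1 -> 2 ^ l <= S a ->
     N (a + 1 * 2 ^ l) + N (a + 2 * 2 ^ l) <= 8 * N a) /\
  (forall l, l < S u -> forall a, a < 2 ^ S l - 1 -> 2 ^ l <= S a -> N a <= C * 4 ^ l).

(* A finite martingale with values in multiples of [4 ^ - m'] that extends [phi / 4 ^ m], lies
   above [gamma / 4 ^ g] plus the supermartingale coded by [N] on level [m'], and makes [p] output
   [i] on input [n]. *)
Definition forcing (p : prog) (m : nat) (phi : nat -> nat) (g : nat) (gamma : nat -> nat) (t : nat)
  (n i : nat) (N : nat -> nat) (c b m' s : nat) : Prop :=
  m <= m' /\
  (forall a, a < 2 ^ S m - 1 -> 4 ^ m * digit c b a = 4 ^ m' * phi a) /\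
  (forall l, l < m' -> forall a, a < 2 ^ S l - 1 -> 2 ^ l <= S a ->
     2 * digit c b a = digit c b (a + 1 * 2 ^ l) + digit c b (a + 2 * 2 ^ l)) /\
  (forall a, a < 2 ^ S m' - 1 -> 2 ^ m' <= S a ->
     4 ^ (m' + t) * gamma a + 4 ^ g * N a <= 4 ^ (g + t) * digit c b a) /\
  ev (partial_oracle c b m') s p [n] = S i.

Definition forced p m phi g gamma t n i N u : Prop :=
  exists c, c < u /\ exists b, b < u /\ exists m', m' < u /\ exists s, s < u /\
    forcing p m phi g gamma t n i N c b m' s.

(** Stage u of the search: supermartingales are cut off at level u and all witnesses are bounded by
    u, so each stage is decidable. Bounding the witnesses by u also makes failure pass from stage u
    + 1 to stage u, as compactness requires. *)
Definition covered p m phi g gamma t C n i u : Prop :=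
  forall d, d < S (C * 4 ^ u) ^ (2 ^ S u) ->
    valid_grid C (digit d (C * 4 ^ u)) u ->
    forced p m phi g gamma t n i (digit d (C * 4 ^ u)) u.

Lemma covered_recursive p m phi g gamma t C i :
  recursive 1 (fun e => phi (nth 0 e 0)) -> recursive 1 (fun e => gamma (nth 0 e 0)) ->
  recursive_rel 2 (fun e => covered p m phi g gamma t C (nth 1 e 0) i (nth 0 e 0)).
Proof.
  intros Hphi Hgamma. unfold covered, forced, forcing, valid_grid.
  repeat (cbn beta; first
    [ match goal with
      | |- recursive _ (fun e => phi _) => apply (recursive_fun1 _ phi _ Hphi)
      | |- recursive _ (fun e => gamma _) => apply (recursive_fun1 _ gamma _ Hgamma)
      | |- recursive _ (fun e => ev _ _ _ _) => apply recursive_ev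
      end
    | rec_step
    | match goal with
      | |- recursive_rel _ (fun e => forall x, x < _ -> _) => apply recursive_rel_forall
      | |- recursive_rel _ (fun e => exists x, x < _ /\ _) => apply recursive_rel_exists
      | |- recursive_rel _ (fun e => _ /\ _) => apply recursive_rel_and
      | |- recursive_rel _ (fun e => _ <= _) => apply recursive_rel_le
      | |- recursive_rel _ (fun e => _ = _) => apply recursive_rel_eq
      | |- recursive_rel _ (fun e => _ -> _) => apply recursive_rel_imp
      end ]).
Qed.

Lemma computable_selection p m phi g gamma t C :
  recursive 1 (fun e => phi (nth 0 e 0)) -> recursive 1 (fun e => gamma (nth 0 e 0)) ->
  (forall n, exists i u, i < 2 /\ covered p m phi g gamma t C n i u) ->
  exists X, computable X /\
    forall n, exists u, covered p m phi g gamma t C n (if X n then 1 else 0) u.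
Proof.
  intros Hphi Hgamma Hall. set (R := covered p m phi g gamma t C) in *.
  assert (Hrec : forall i, recursive_rel 2 (fun e => R (nth 1 e 0) i (nth 0 e 0))).
  { intros i. apply covered_recursive; auto. }
  destruct (recursive_mu 1 (fun e => chi (~ (R (nth 1 e 0) 0 (nth 0 e 0) \/ R (nth 1 e 0) 1 (nth 0 e 0)))))
    as (h & Hh & Hmu).
  - apply recursive_rel_not, recursive_rel_or; auto.
  - intros [|n [|]]; try discriminate. intros _. destruct (Hall n) as (i & u & Hi & Hu).
    exists u. simpl. apply chi_false. intros H. apply H.
    destruct i as [|[|]]; auto; lia.
  - assert (Hx : recursive 1 (fun e => chi (R (nth 0 e 0) 1 (h e)))).
    { apply (recursive_comp 1 2 (fun e => chi (R (nth 1 e 0) 1 (nth 0 e 0))) [h; fun e => nth 0 e 0]);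
        auto using recursive_var, tails_id. apply Hrec. }
    destruct Hx as [px Hpx].
    (* If both bits are covered at the stage found, 1 is taken; if 1 is not covered there, 0 is. *)
    exists (fun n => if excluded_middle_informative (R n 1 (h [n])) then true else false). split.
    + exists px. intros n. specialize (Hpx [n] eq_refl). simpl in Hpx. unfold chi in Hpx.
      destruct excluded_middle_informative; auto.
    + intros n. exists (h [n]). specialize (Hmu [n] eq_refl). simpl in Hmu.
      destruct excluded_middle_informative as [|H1]; auto.
      destruct (classic (R n 0 (h [n]))) as [|H0]; auto.
      rewrite chi_true in Hmu; [discriminate|tauto].
Qed.

Lemma valid_grid_ext C N N' u :
  (forall a, a < 2 ^ S u - 1 -> N a = N' a) -> valid_grid C N u -> valid_grid C N' u.
Proof.
  intros E (H0 & H1 & H2).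
  assert (Hlt : forall rho, length rho <= u -> N (encode_str rho) = N' (encode_str rho)).
  { intros rho Hr. apply E, code_bound; auto. }
  split; [specialize (Hlt []); simpl in Hlt; rewrite <- Hlt; [auto|lia]|]. split.
  - intros l Hl a Ha Ha'. specialize (H1 l Hl a Ha Ha').
    destruct (code_level l a Ha Ha') as (rho & <- & <-).
    rewrite <- (encode_snoc rho false), <- (encode_snoc rho true) in *.
    rewrite !Hlt in H1 by (rewrite ?length_app; simpl; lia). auto.
  - intros l Hl a Ha Ha'. specialize (H2 l Hl a Ha Ha').
    destruct (code_level l a Ha Ha') as (rho & <- & <-).
    rewrite Hlt in H2 by lia. auto.
Qed.

Lemma forced_ext p m phi g gamma t n i N N' u :
  (forall a, a < 2 ^ S u - 1 -> N a = N' a) ->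
  forced p m phi g gamma t n i N u -> forced p m phi g gamma t n i N' u.
Proof.
  intros E (c & Hc & b & Hb & m' & Hm & s & Hs & H1 & H2 & H3 & H4 & H5).
  exists c; split; auto. exists b; split; auto. exists m'; split; auto. exists s; split; auto.
  repeat split; auto. intros a Ha Ha'. rewrite <- E; auto.
  destruct (code_level m' a Ha Ha') as (rho & <- & <-). apply code_bound. lia.
Qed.

(** Failure at stage u depends only on the values on strings of length at most u, and these are
    bounded by [valid_grid], so failures at all stages yield one infinite counterexample. The bound
    at code k uses that the string of code k has length at most k. *)
Lemma uncovered_grid p m phi g gamma t C n i :
  (forall u, ~ covered p m phi g gamma t C n i u) ->
  exists N, forall u, valid_grid C N u /\ ~ forced p m phi g gamma t n i N u.
Proof.
  intros Hn.
  apply konig with (bound := fun k => C * 4 ^ k) (d := fun u => 2 ^ S u - 1).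
  - intros u f [(H0 & H1 & H2) H3]. split.
    + split; [|split]; auto.
    + intros (c & Hc & b & Hb & m' & Hm & s & Hs & H). apply H3.
      exists c; split; auto. exists b; split; auto. exists m'; split; auto. exists s; auto.
  - intros u f f' E [H1 H2]. split; [eapply valid_grid_ext; eauto|].
    intros H. apply H2. eapply forced_ext; [|exact H]. intros; symmetry; auto.
  - intros u f [(_ & _ & H) _] k Hk.
    pose proof (encode_bounds (decode_str k)) as [Hb1 Hb2]. rewrite encode_decode in *.
    pose proof (code_length_le k) as Hl.
    rewrite (H (length (decode_str k))); auto; [|lia].
    apply Nat.mul_le_mono_l, Nat.pow_le_mono_r; lia.
  - intros u. specialize (Hn u). apply not_all_ex_not in Hn as [d Hd].
    exists (digit d (C * 4 ^ u)). tauto.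
Qed.

Lemma covered_grid p m phi g gamma t C n i u N :
  covered p m phi g gamma t C n i u -> valid_grid C N u -> forced p m phi g gamma t n i N u.
Proof.
  intros Hc HN.
  destruct (digit_surj (C * 4 ^ u) (2 ^ S u - 1) N) as (d & Hd & Hdig).
  { intros a Ha. pose proof (code_length u a Ha) as Hl.
    pose proof (encode_bounds (decode_str a)) as [Hb1 Hb2]. rewrite encode_decode in *.
    destruct HN as (_ & _ & H). rewrite (H (length (decode_str a))); auto; [|lia].
    apply Nat.mul_le_mono_l, Nat.pow_le_mono_r; lia. }
  apply (forced_ext p m phi g gamma t n i (digit d (C * 4 ^ u))); auto.
  apply Hc.
  - eapply Nat.lt_le_trans; [exact Hd|]. apply Nat.pow_le_mono_r; lia.
  - apply (valid_grid_ext C N); auto. intros; symmetry; auto.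
Qed.

End Codes.

(** * Martingales *)

Lemma martingale_plus M M' : martingale M -> martingale M' -> martingale (fun rho => M rho + M' rho).
Proof.
  intros [H0 H1] [H0' H1']. split; intros rho.
  - specialize (H0 rho). specialize (H0' rho). lra.
  - specialize (H1 rho). specialize (H1' rho). lra.
Qed.

Lemma bounded_plus M M' :
  bounded_fun M -> bounded_fun M' -> bounded_fun (fun rho => M rho + M' rho).
Proof.
  intros [C H] [C' H']. exists (C + C'). intros rho.
  eapply Rle_trans; [apply Rabs_triang|]. specialize (H rho). specialize (H' rho). lra.
Qed.

Lemma martingale_growth M rho : martingale M -> M rho <= 2 ^ length rho * M [].
Proof.
  intros [H0 H1]. induction rho as [|b r IH] using rev_ind; [simpl; lra|].
  rewrite length_app, Nat.add_1_r. simpl.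
  specialize (H1 r). pose proof (H0 (r ++ [false])). pose proof (H0 (r ++ [true])).
  destruct b; lra.
Qed.

Lemma firstn_snoc_lt m (rho : list bool) b :
  (length rho < m)%nat -> firstn m rho = rho /\ firstn m (rho ++ [b]) = rho ++ [b].
Proof.
  intros H. rewrite !firstn_all2; auto; [rewrite length_app; simpl|]; lia.
Qed.

Lemma firstn_snoc_ge m (rho : list bool) b :
  (m <= length rho)%nat -> firstn m (rho ++ [b]) = firstn m rho.
Proof.
  intros H. rewrite firstn_app. replace (m - length rho)%nat with 0%nat by lia.
  apply app_nil_r.
Qed.

Lemma martingale_stop m M : martingale M -> martingale (fun rho => M (firstn m rho)).
Proof.
  intros [H0 H1]. split; auto. intros rho.
  destruct (Nat.lt_ge_cases (length rho) m) as [H|H].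
  - destruct (firstn_snoc_lt m rho false H) as [-> ->].
    destruct (firstn_snoc_lt m rho true H) as [_ ->]. auto.
  - rewrite !firstn_snoc_ge by auto. lra.
Qed.

(** Backward induction from level m, each value being the mean of those at the children. Only the
    averaging equation is assumed, so the lemma can serve to prove nonnegativity of F, as in
    [condition_raise]. *)
Lemma martingale_lt_level M F m :
  (forall rho, 2 * M rho = M (rho ++ [false]) + M (rho ++ [true])) ->
  (forall rho, 2 * F rho = F (rho ++ [false]) + F (rho ++ [true])) ->
  (forall rho, length rho = m -> M rho < F rho) ->
  forall rho, (length rho <= m)%nat -> M rho < F rho.
Proof.
  intros HM HF Hm rho Hr. remember (m - length rho)%nat as k eqn:Hk.
  revert rho Hr Hk. induction k as [|k IH]; intros rho Hr Hk; [apply Hm; lia|].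
  specialize (HM rho). specialize (HF rho).
  pose proof (IH (rho ++ [false])) as E0. pose proof (IH (rho ++ [true])) as E1.
  rewrite length_app in E0, E1. simpl in E0, E1.
  specialize (E0 ltac:(lia) ltac:(lia)). specialize (E1 ltac:(lia) ltac:(lia)). lra.
Qed.

Lemma level_gap m : forall X : list bool -> R, (forall rho, length rho = m -> 0 < X rho) ->
  exists d, 0 < d /\ forall rho, length rho = m -> d <= X rho.
Proof.
  induction m as [|m IH]; intros X HX.
  - exists (X []). split; [apply HX; auto|]. intros [|] H; [lra|discriminate].
  - destruct (IH (fun r => X (false :: r))) as (d0 & Hd0 & H0); [intros; apply HX; simpl; auto|].
    destruct (IH (fun r => X (true :: r))) as (d1 & Hd1 & H1); [intros; apply HX; simpl; auto|].
    exists (Rmin d0 d1). split; [apply Rmin_glb_lt; auto|].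
    intros [|b r] Hr; [discriminate|]. injection Hr as Hr.
    destruct b; [eapply Rle_trans; [apply Rmin_r|auto] | eapply Rle_trans; [apply Rmin_l|auto]].
Qed.

(** * Conditional means, submartingales and supermartingales *)

(** The conditional expectation, given rho, of g at depth k below rho under fair coin tossing. *)
Fixpoint avg (g : list bool -> R) (k : nat) (rho : list bool) : R :=
  match k with
  | O => g rho
  | S k => (avg g k (rho ++ [false]) + avg g k (rho ++ [true])) / 2
  end.

Lemma avg_le g h k : forall rho,
  (forall tau, length tau = k -> g (rho ++ tau) <= h (rho ++ tau)) -> avg g k rho <= avg h k rho.
Proof.
  induction k as [|k IH]; intros rho H; simpl.
  - specialize (H [] eq_refl). rewrite app_nil_r in H. auto.
  - assert (forall b, avg g k (rho ++ [b]) <= avg h k (rho ++ [b])) as E.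
    { intros b. apply IH. intros tau Ht. rewrite <- app_assoc. apply H. simpl; auto. }
    pose proof (E false). pose proof (E true). lra.
Qed.

Lemma avg_ext g h k rho :
  (forall tau, length tau = k -> g (rho ++ tau) = h (rho ++ tau)) -> avg g k rho = avg h k rho.
Proof.
  intros H. apply Rle_antisym; apply avg_le; intros; rewrite H; auto; lra.
Qed.

Lemma avg_lin a g h k : forall rho,
  avg (fun s => a * g s + h s) k rho = a * avg g k rho + avg h k rho.
Proof. induction k as [|k IH]; intros rho; simpl; [lra|]. rewrite !IH. lra. Qed.

Lemma avg_const c k : forall rho, avg (fun _ => c) k rho = c.
Proof. induction k as [|k IH]; intros rho; simpl; [lra|]. rewrite !IH. lra. Qed.

Lemma avg_avg g j k : forall rho, avg (avg g j) k rho = avg g (k + j) rho.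
Proof. induction k as [|k IH]; intros rho; simpl; [lra|]. rewrite !IH. lra. Qed.

Lemma avg_martingale M k : martingale M -> forall rho, avg M k rho = M rho.
Proof.
  intros [_ H]. induction k as [|k IH]; intros rho; simpl; [lra|]. rewrite !IH.
  specialize (H rho). lra.
Qed.

Definition submartingale (h : list bool -> R) : Prop :=
  forall rho, 2 * h rho <= h (rho ++ [false]) + h (rho ++ [true]).

Lemma avg_growing h rho : submartingale h -> Un_growing (fun k => avg h k rho).
Proof.
  intros H k. rewrite <- Nat.add_1_r, <- avg_avg. apply avg_le. intros tau _. simpl.
  specialize (H (rho ++ tau)). lra.
Qed.

Lemma Un_cv_const c : Un_cv (fun _ => c) c.
Proof.
  intros eps Heps. exists 0%nat. intros. unfold Rdist. rewrite Rminus_diag, Rabs_R0. auto.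
Qed.

(** The means of h at depth k below rho increase with k and are bounded by C. Their limit satisfies
    the martingale equation because depth k + 1 at rho is depth k at its children. *)
Lemma submartingale_majorant h C :
  submartingale h -> (forall rho, 0 <= h rho <= C) ->
  exists H, martingale H /\ (forall rho, h rho <= H rho <= C) /\
    forall rho, Un_cv (fun k => avg h k rho) (H rho).
Proof.
  intros Hs Hb.
  assert (Hub : forall k rho, avg h k rho <= C).
  { intros k rho. rewrite <- (avg_const C k rho). apply avg_le. intros. apply Hb. }
  assert (forall rho, exists l, Un_cv (fun k => avg h k rho) l) as Hcv.
  { intros rho. destruct (growing_cv (fun k => avg h k rho)) as [l Hl]; [|eauto|eauto].
    - apply avg_growing; auto.
    - exists C. intros x [k ->]. auto. }
  destruct (choice _ Hcv) as [H HH]. exists H.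
  assert (Hlow : forall rho, h rho <= H rho).
  { intros rho. apply (growing_ineq (fun k => avg h k rho) (H rho) (avg_growing h rho Hs) (HH rho) 0%nat). }
  split; [split|split]; auto.
  - intros rho. specialize (Hlow rho). specialize (Hb rho). lra.
  - intros rho. apply UL_sequence with (fun k => avg h k (rho ++ [false]) + avg h k (rho ++ [true])).
    + intros eps Heps. destruct (HH rho (eps / 2)) as [n Hn]; [lra|]. exists n. intros k Hk.
      specialize (Hn (S k) ltac:(lia)). unfold Rdist in *. simpl in Hn.
      replace (avg h k (rho ++ [false]) + avg h k (rho ++ [true]) - 2 * H rho) with
        (2 * ((avg h k (rho ++ [false]) + avg h k (rho ++ [true])) / 2 - H rho)) by lra.
      rewrite Rabs_mult, Rabs_right by lra. lra.
    + apply CV_plus; auto.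
  - intros rho. split; auto.
    apply Rle_cv_lim with (fun k => avg h k rho) (fun _ => C); auto using Un_cv_const.
Qed.

(** A greedy splitting of the capital works: if the left child gets the least admissible amount,
    what remains for the right child is at least n by the supermartingale inequality. The cap C
    keeps the greedy choice from piling up unbounded capital on one side. *)
Lemma supermartingale_majorant n C v :
  (forall rho, n (rho ++ [false]) + n (rho ++ [true]) <= 2 * n rho) ->
  (forall rho, 0 <= n rho <= C) -> n [] <= v <= C ->
  exists H, martingale H /\ (forall rho, n rho <= H rho <= C) /\ H [] = v.
Proof.
  intros Hs Hb Hv.
  (* Here x is the least value for the left child that is at least n there and leaves at most C to
     the right child. The fold carries the current string along with the capital. *)
  set (step := fun (st : list bool * R) (b : bool) =>
    let x := Rmax (n (fst st ++ [false])) (2 * snd st - C) in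
    (fst st ++ [b], if b then 2 * snd st - x else x)).
  set (st := fun rho => fold_left step rho ([], v)).
  assert (Hfst : forall rho, fst (st rho) = rho).
  { induction rho as [|b r IH] using rev_ind; auto.
    unfold st. rewrite fold_left_app. simpl. fold (st r). rewrite IH. auto. }
  set (H := fun rho => snd (st rho)).
  assert (HS : forall rho b, H (rho ++ [b]) =
    let x := Rmax (n (rho ++ [false])) (2 * H rho - C) in if b then 2 * H rho - x else x).
  { intros rho b. unfold H at 1, st. rewrite fold_left_app. simpl. fold (st rho).
    rewrite Hfst. auto. }
  assert (Hbd : forall rho, n rho <= H rho <= C).
  { induction rho as [|b r IH] using rev_ind; auto.
    rewrite HS. cbn zeta. specialize (Hs r).
    pose proof (Hb (r ++ [false])). pose proof (Hb (r ++ [true])).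
    unfold Rmax. destruct b, Rle_dec; lra. }
  exists H. split; [split|split]; auto.
  - intros rho. specialize (Hb rho). specialize (Hbd rho). lra.
  - intros rho. rewrite !HS. cbn zeta. lra.
Qed.

(** * Approximation by finite dyadic martingales *)

Definition on_grid (m : nat) (F : list bool -> R) : Prop :=
  forall rho, exists z, F rho * 4 ^ m = IZR z.

Definition step_fun (m : nat) (F : list bool -> R) : Prop :=
  forall rho, F (firstn m rho) = F rho.

(** Values on level m are rounded up to multiples of 2^-m, and shorter strings receive the means.
    Averaging over at most m levels costs another factor 2^m, which is the origin of the grid
    4^-m. *)
Lemma dyadic_approx X m : martingale X ->
  exists G, martingale G /\ step_fun m G /\ on_grid m G /\
    forall rho, (length rho <= m)%nat -> X rho <= G rho <= X rho + (/ 2) ^ m.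
Proof.
  intros HX. pose proof HX as [HX0 HX1].
  assert (H2 : forall k, 0 < 2 ^ k) by (intros; apply pow_lt; lra).
  assert (Hinv : forall k, (/ 2) ^ k = / 2 ^ k) by (intros; apply pow_inv).
  set (r := fun rho => IZR (up (X rho * 2 ^ m)) / 2 ^ m).
  assert (Hr : forall rho, X rho <= r rho <= X rho + (/ 2) ^ m).
  { intros rho. unfold r. destruct (archimed (X rho * 2 ^ m)) as [A1 A2].
    rewrite Hinv. specialize (H2 m). split.
    - apply Rmult_le_reg_r with (2 ^ m); auto. unfold Rdiv.
      rewrite Rmult_assoc, Rinv_l by lra. lra.
    - apply Rmult_le_reg_r with (2 ^ m); auto. unfold Rdiv.
      rewrite Rmult_assoc, Rmult_plus_distr_r, Rinv_l by lra. lra. }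
  set (G := fun rho => avg (fun s => r (firstn m s)) (m - length rho) rho).
  assert (HG : forall rho, (length rho <= m)%nat -> X rho <= G rho <= X rho + (/ 2) ^ m).
  { intros rho Hl. unfold G.
    assert (forall tau, length tau = (m - length rho)%nat -> firstn m (rho ++ tau) = rho ++ tau) as E.
    { intros tau Ht. apply firstn_all2. rewrite length_app. lia. }
    split.
    - rewrite <- (avg_martingale X (m - length rho) HX rho) at 1. apply avg_le.
      intros tau Ht. rewrite E by auto. apply Hr.
    - replace (X rho + (/ 2) ^ m) with (1 * avg X (m - length rho) rho + avg (fun _ => (/ 2) ^ m) (m - length rho) rho)
        by (rewrite avg_martingale, avg_const by auto; lra).
      rewrite <- avg_lin. apply avg_le. intros tau Ht. rewrite E by auto.
      specialize (Hr (rho ++ tau)). lra. }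
  assert (Hstep : step_fun m G).
  { intros rho. destruct (Nat.le_gt_cases (length rho) m) as [H|H].
    - rewrite firstn_all2; auto.
    - unfold G. rewrite length_firstn. replace (m - min m (length rho))%nat with 0%nat by lia.
      replace (m - length rho)%nat with 0%nat by lia. simpl. rewrite firstn_firstn, Nat.min_id. auto. }
  exists G. split; [split|split; [|split]]; auto.
  - intros rho. rewrite <- Hstep. destruct (HG (firstn m rho)) as [A _]; [apply firstn_le_length|].
    specialize (HX0 (firstn m rho)). lra.
  - intros rho. destruct (Nat.lt_ge_cases (length rho) m) as [H|H].
    + unfold G. rewrite !length_app. simpl.
      replace (m - length rho)%nat with (S (m - (length rho + 1))) by lia. simpl. lra.
    + rewrite <- (Hstep (rho ++ [false])), <- (Hstep (rho ++ [true])), !firstn_snoc_ge, Hstep by auto. lra.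
  - intros rho. unfold G.
    assert (forall k rho, exists z, avg (fun s => r (firstn m s)) k rho * (2 ^ k * 2 ^ m) = IZR z) as E.
    { clear - H2. induction k as [|k IH]; intros rho.
      - exists (up (X (firstn m rho) * 2 ^ m)). simpl. unfold r. specialize (H2 m). field. lra.
      - destruct (IH (rho ++ [false])) as [z0 E0]. destruct (IH (rho ++ [true])) as [z1 E1].
        exists (z0 + z1)%Z. rewrite plus_IZR, <- E0, <- E1. simpl. field. }
    destruct (E (m - length rho)%nat rho) as [z Hz].
    exists (z * 2 ^ Z.of_nat (m - (m - length rho)))%Z.
    rewrite mult_IZR, <- Hz, <- pow_IZR. replace 4 with (2 * 2) by lra.
    assert (2 ^ m = 2 ^ (m - length rho) * 2 ^ (m - (m - length rho))) as Em
      by (rewrite <- pow_add; f_equal; lia).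
    rewrite Rpow_mult_distr. rewrite Em at 2. ring.
Qed.

(* L2-convergence: the error [H] is the martingale generated by the submartingale
   [eta / 2 + (M - M_g)^2 / (2 eta)], which dominates [M - M_g] by AM-GM. *)
Lemma bounded_decomposition M eta m0 :
  martingale M -> bounded_fun M -> 0 < eta ->
  exists g G H, (m0 <= g)%nat /\ martingale G /\ step_fun g G /\ on_grid g G /\
    (forall rho, (length rho <= g)%nat -> G rho <= M rho + (/ 2) ^ g) /\
    martingale H /\ bounded_fun H /\ H [] <= eta /\ forall rho, M rho <= G rho + H rho.
Proof.
  intros HM [C HC] Heta. pose proof HM as [HM0 HM1].
  assert (HC' : forall rho, 0 <= M rho <= C).
  { intros rho. split; auto. specialize (HC rho). rewrite Rabs_right in HC; auto. apply Rle_ge; auto. }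
  set (M2 := fun rho => M rho * M rho).
  assert (HM2 : submartingale M2).
  { intros rho. unfold M2. specialize (HM1 rho).
    replace (M (rho ++ [true])) with (2 * M rho - M (rho ++ [false])) by lra.
    pose proof (Rle_0_sqr (M rho - M (rho ++ [false]))). unfold Rsqr in *. lra. }
  destruct (submartingale_majorant M2 (C * C) HM2) as (L & _ & _ & HL).
  { intros rho. specialize (HC' rho). unfold M2. nra. }
  (* From g0 on, the mean of M^2 is within eta^2 of its limit, so it grows by at most eta^2 after
     level g. *)
  destruct (HL [] (eta * eta)) as [g0 Hg0]; [nra|].
  set (g := (g0 + m0)%nat).
  assert (Hen : forall j, avg M2 (g + j) [] - avg M2 g [] <= eta * eta).
  { intros j. specialize (Hg0 g ltac:(lia)). unfold Rdist in Hg0. apply Rabs_def2 in Hg0.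
    pose proof (growing_ineq _ _ (avg_growing M2 [] HM2) (HL []) (g + j)). simpl in H. lra. }
  destruct (dyadic_approx M g HM) as (G & HG & HGs & HGg & HGb).
  set (D := fun rho => M rho - M (firstn g rho)).
  set (h := fun rho => / (2 * eta) * (D rho * D rho) + eta / 2).
  assert (Hk : 0 < / (2 * eta)) by (apply Rinv_0_lt_compat; lra).
  assert (Hh : submartingale h).
  { intros rho. unfold h. pose proof (HM1 rho) as E1.
    pose proof (proj2 (martingale_stop g M HM) rho) as E2. simpl in E2.
    assert (E : 2 * D rho = D (rho ++ [false]) + D (rho ++ [true])) by (unfold D; lra).
    replace (D (rho ++ [true])) with (2 * D rho - D (rho ++ [false])) by lra.
    pose proof (Rle_0_sqr (D rho - D (rho ++ [false]))). unfold Rsqr in *. nra. }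
  assert (Hhb : forall rho, 0 <= h rho <= / (2 * eta) * (C * C) + eta / 2).
  { intros rho. unfold h.
    assert (0 <= D rho * D rho <= C * C).
    { unfold D. pose proof (HC' rho). pose proof (HC' (firstn g rho)). split; [apply Rle_0_sqr|]. nra. }
    split; [nra|]. apply Rplus_le_compat_r, Rmult_le_compat_l; lra. }
  destruct (submartingale_majorant h _ Hh Hhb) as (H & HH & HHb & HHcv).
  exists g, G, H. split; [lia|]. repeat (split; [solve [auto | intros; apply HGb; auto]|]).
  split; [|split].
  - exists (/ (2 * eta) * (C * C) + eta / 2). intros rho. specialize (HHb rho). specialize (Hhb rho).
    rewrite Rabs_right; lra.
  - apply Rle_cv_lim with (fun k => avg h k []) (fun _ => eta); auto using Un_cv_const.
    intros k. apply Rle_trans with (avg h (g + k) []).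
    { apply Rge_le, (growing_prop (fun k => avg h k [])); [apply avg_growing; auto|lia]. }
    rewrite <- avg_avg.
    (* Orthogonality of increments: below a string tau of length g, the mean of (M - M tau)^2 is the
       mean of M^2 minus (M tau)^2. In total at most eta^2 is left, and eta^2 / (2 eta) + eta / 2 =
       eta. *)
    rewrite (avg_ext _ (fun s => / (2 * eta) * (-1 * M2 s + avg M2 k s) + eta / 2)).
    + rewrite avg_lin, avg_const, avg_lin, avg_avg. specialize (Hen k).
      assert (/ (2 * eta) * (avg M2 (g + k) [] - avg M2 g []) <= / (2 * eta) * (eta * eta)) as E
        by (apply Rmult_le_compat_l; lra).
      replace (/ (2 * eta) * (eta * eta)) with (eta / 2) in E by (field; lra). lra.
    + intros tau Ht. simpl. unfold h.
      rewrite (avg_lin (/ (2 * eta)) (fun s => D s * D s)), avg_const. do 2 f_equal.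
      rewrite (avg_ext _ (fun s => (-2 * M tau) * M s + (1 * M2 s + M tau * M tau))).
      * rewrite avg_lin, avg_lin, avg_const, avg_martingale by auto. unfold M2. lra.
      * intros tau' _. unfold D. rewrite firstn_app, Ht, Nat.sub_diag, <- Ht, firstn_all, app_nil_r.
        unfold M2. lra.
  - intros rho. rewrite <- HGs.
    pose proof (HGb (firstn g rho) (firstn_le_length _ _)). specialize (HHb rho).
    enough (D rho <= h rho) by (unfold D in *; lra).
    unfold h. apply Rmult_le_reg_l with (2 * eta); [lra|].
    rewrite Rmult_plus_distr_l, <- Rmult_assoc, Rinv_r by lra.
    pose proof (Rle_0_sqr (D rho - eta)). unfold Rsqr in *. lra.
Qed.

(** * Grid values and oracle answers *)

Lemma INR_pow4 m : INR (4 ^ m) = 4 ^ m.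
Proof. rewrite pow_INR. simpl INR. f_equal. lra. Qed.

Lemma pow4_pos m : 0 < 4 ^ m.
Proof. apply pow_lt. lra. Qed.

Lemma Int_part_quotient x f d :
  (d <> 0)%nat -> x * INR d = INR f -> Z.to_nat (Int_part x) = (f / d)%nat.
Proof.
  intros Hd Hx.
  rewrite <- (Int_part_spec x (Z.of_nat (f / d))); [apply Nat2Z.id|].
  rewrite <- INR_IZR_INZ.
  pose proof (Nat.div_mod f d Hd) as E. pose proof (Nat.mod_upper_bound f d Hd) as Hr.
  assert (0 < INR d) as Hd' by (apply lt_0_INR; lia).
  apply (f_equal INR) in E. rewrite plus_INR, mult_INR in E.
  pose proof (pos_INR (f mod d)). apply lt_INR in Hr.
  split; apply Rmult_lt_reg_r with (INR d) || apply Rmult_le_reg_r with (INR d); nra.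
Qed.

(** On the grid every oracle answer is integer arithmetic in the numerator f. This is the form built
    into [partial_oracle], so one exact value settles the queries about its string at all digit
    positions. *)
Lemma oracle_of_grid S m a f j :
  S (decode_str a) * 4 ^ m = INR f ->
  oracle_of S a j =
    (if j =? 0 then f / 4 ^ m else (f * 2 ^ j / 4 ^ m) mod 2)%nat.
Proof.
  intros H. assert (4 ^ m <> 0)%nat by (apply Nat.pow_nonzero; lia).
  destruct j as [|j]; unfold oracle_of; cbn [Nat.eqb].
  - apply Int_part_quotient; auto. rewrite INR_pow4. auto.
  - rewrite (Int_part_quotient _ (f * 2 ^ Datatypes.S j) (4 ^ m)); auto.
    rewrite INR_pow4, mult_INR, <- H, (pow_INR 2). change (INR 2) with 2. ring.
Qed.

Lemma floor_bounds x : 0 <= x ->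
  INR (Z.to_nat (Int_part x)) <= x < INR (Z.to_nat (Int_part x)) + 1.
Proof.
  intros Hx. destruct (base_Int_part x) as [H1 H2].
  assert (0 <= Int_part x)%Z as H0.
  { assert (-1 < IZR (Int_part x)) by lra. apply lt_IZR in H. lia. }
  rewrite INR_IZR_INZ, Z2Nat.id by auto. lra.
Qed.

Lemma grid_nat m F : martingale F -> on_grid m F -> step_fun m F ->
  exists f : list bool -> nat, (forall rho, INR (f rho) = F rho * 4 ^ m) /\
    (forall rho, f (firstn m rho) = f rho).
Proof.
  intros [H0 _] Hg Hs.
  assert (forall rho, exists k, INR k = F rho * 4 ^ m) as Hk.
  { intros rho. destruct (Hg rho) as [z Hz]. exists (Z.to_nat z).
    rewrite Hz, INR_IZR_INZ, Z2Nat.id; auto. apply le_IZR. rewrite <- Hz.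
    apply Rmult_le_pos; auto. left. apply pow4_pos. }
  destruct (choice _ Hk) as [f Hf]. exists f. split; auto.
  intros rho. apply INR_eq. rewrite !Hf, Hs. auto.
Qed.

(** Turns a counterexample found by compactness into a bounded martingale that can be added to M.
    The initial value 3 / 4^t is the cap at the root in [valid_grid], and 3 <= C keeps it below the
    overall bound C / 4^t. *)
Lemma grid_martingale N t C : (forall u, valid_grid C N u) -> (3 <= C)%nat ->
  exists H, martingale H /\ bounded_fun H /\ H [] = 3 / 4 ^ t /\
    forall rho, INR (N (encode_str rho)) / 4 ^ (length rho + t) <= H rho.
Proof.
  intros HN HC.
  set (n := fun rho => INR (N (encode_str rho)) / 4 ^ (length rho + t)).
  pose proof (pow4_pos t) as Ht.
  assert (Hp : forall l, 0 < / 4 ^ (l + t)) by (intros; apply Rinv_0_lt_compat, pow4_pos).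
  destruct (supermartingale_majorant n (INR C / 4 ^ t) (3 / 4 ^ t)) as (H & HH & HHb & HH0).
  - intros rho. unfold n. rewrite !length_app, !encode_snoc. simpl length.
    destruct (HN (S (length rho))) as (_ & H1 & _).
    destruct (encode_bounds rho) as [Hb1 Hb2].
    specialize (H1 (length rho) ltac:(lia) _ Hb2 Hb1). apply le_INR in H1.
    rewrite plus_INR, mult_INR in H1. replace (INR 8) with 8 in H1 by (simpl; lra).
    replace (length rho + 1 + t)%nat with (S (length rho + t)) by lia.
    specialize (Hp (length rho)). set (w := 4 ^ (length rho + t)) in *.
    assert (w <> 0) by (intros E; rewrite E, Rinv_0 in Hp; lra).
    simpl pow. fold w. unfold Rdiv. rewrite Rinv_mult.
    apply Rmult_le_compat_r with (r := / 4 * / w) in H1; [lra|lra].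
  - intros rho. unfold n. split.
    + apply Rmult_le_pos; [apply pos_INR|left; auto].
    + destruct (HN (S (length rho))) as (_ & _ & H2).
      destruct (encode_bounds rho) as [Hb1 Hb2].
      specialize (H2 (length rho) ltac:(lia) _ Hb2 Hb1). apply le_INR in H2.
      rewrite mult_INR, INR_pow4 in H2. pose proof (pow4_pos (length rho)).
      apply Rmult_le_compat_r with (r := / 4 ^ (length rho + t)) in H2; [|left; auto].
      eapply Rle_trans; [exact H2|]. rewrite pow_add. right. field. lra.
  - destruct (HN 0%nat) as (H0 & _). unfold n. simpl.
    apply le_INR in H0, HC. simpl in H0, HC.
    assert (0 < / 4 ^ t) by (apply Rinv_0_lt_compat; auto). unfold Rdiv.
    split; apply Rmult_le_compat_r; lra.
  - exists H. split; auto. split; [|split; auto].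
    + exists (INR C / 4 ^ t). intros rho. rewrite Rabs_right; [apply HHb|].
      apply Rle_ge, HH.
    + intros rho. apply HHb.
Qed.

(** For x = H rho 4^(|rho| + t), the integer floor(x) + 2 is above x + 1 and at most x + 2. The
    codes of the two children exceed 8 x by at most 4 in total, while 8 times the code of the parent
    exceeds it by more than 8, so rounding keeps the supermartingale inequality. At the root the
    code is at most 1 + 2 = 3. *)
Lemma martingale_grid H t : martingale H -> bounded_fun H -> H [] * 4 ^ t <= 1 ->
  exists N C, (3 <= C)%nat /\ (forall u, valid_grid C N u) /\
    forall rho, H rho < INR (N (encode_str rho)) / 4 ^ (length rho + t).
Proof.
  intros [H0 H1] [B HB] Ht.
  set (x := fun rho => H rho * 4 ^ (length rho + t)).
  assert (Hx : forall rho, 0 <= x rho).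
  { intros rho. apply Rmult_le_pos; auto. left. apply pow4_pos. }
  set (N := fun a => (Z.to_nat (Int_part (x (decode_str a))) + 2)%nat).
  assert (HN : forall rho, x rho + 1 < INR (N (encode_str rho)) <= x rho + 2).
  { intros rho. unfold N. rewrite decode_encode, plus_INR. change (INR 2) with 2.
    pose proof (floor_bounds (x rho) (Hx rho)). lra. }
  destruct (INR_archimed 1 (B * 4 ^ t + 3)) as [C0 HC0]; [lra|].
  exists N, (C0 + 3)%nat. split; [lia|]. split; [|].
  - intros u. split; [|split].
    + change 0%nat with (encode_str []). apply INR_le. destruct (HN []) as [_ A].
      unfold x in A. simpl in *. lra.
    + intros l _ a Ha Ha'. destruct (code_level l a Ha Ha') as (rho & <- & <-).
      rewrite <- (encode_snoc rho false), <- (encode_snoc rho true).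
      apply INR_le. rewrite plus_INR, mult_INR. replace (INR 8) with 8 by (simpl; lra).
      pose proof (HN rho). pose proof (HN (rho ++ [false])). pose proof (HN (rho ++ [true])).
      assert (x (rho ++ [false]) + x (rho ++ [true]) = 8 * x rho).
      { unfold x. rewrite !length_app. simpl length.
        replace (length rho + 1 + t)%nat with (S (length rho + t)) by lia. simpl pow.
        specialize (H1 rho).
        replace (H (rho ++ [true])) with (2 * H rho - H (rho ++ [false])) by lra. ring. }
      lra.
    + intros l _ a Ha Ha'. destruct (code_level l a Ha Ha') as (rho & <- & <-).
      apply INR_le. rewrite mult_INR, INR_pow4, plus_INR. simpl INR at 3.
      destruct (HN rho) as [_ A]. eapply Rle_trans; [exact A|].
      assert (1 <= 4 ^ length rho) by (apply pow_R1_Rle; lra).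
      assert (x rho <= B * 4 ^ t * 4 ^ length rho).
      { unfold x. rewrite pow_add. rewrite (Rmult_comm (4 ^ length rho)), <- Rmult_assoc.
        apply Rmult_le_compat_r; [lra|]. apply Rmult_le_compat_r; [left; apply pow4_pos|].
        eapply Rle_trans; [apply Rle_abs|apply HB]. }
      pose proof (pos_INR C0). nra.
  - intros rho. destruct (HN rho) as [A _]. pose proof (pow4_pos (length rho + t)).
    apply Rmult_lt_reg_r with (4 ^ (length rho + t)); auto.
    unfold Rdiv. rewrite Rmult_assoc, Rinv_l by lra. fold (x rho). lra.
Qed.

(** * Forcing conditions *)

Definition condition (m : nat) (F M : list bool -> R) : Prop :=
  martingale F /\ step_fun m F /\ on_grid m F /\ martingale M /\ bounded_fun M /\
  forall rho, length rho = m -> M rho < F rho.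

Definition extends (m : nat) (F M : list bool -> R) (m' : nat) (F' M' : list bool -> R) : Prop :=
  (m <= m')%nat /\ (forall rho, (length rho <= m)%nat -> F' rho = F rho) /\
  forall rho, M rho <= M' rho.

Lemma extends_refl m F M : extends m F M m F M.
Proof. split; [auto|split; auto]. intros; lra. Qed.

Lemma extends_trans m F M m1 F1 M1 m2 F2 M2 :
  extends m F M m1 F1 M1 -> extends m1 F1 M1 m2 F2 M2 -> extends m F M m2 F2 M2.
Proof.
  intros (Hm & HF & HM) (Hm' & HF' & HM'). split; [lia|split].
  - intros rho Hr. rewrite HF' by lia. auto.
  - intros rho. eapply Rle_trans; eauto.
Qed.

Lemma half_pow_small d : 0 < d -> exists n0, forall n, (n0 <= n)%nat -> (/ 2) ^ n < d.
Proof.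
  intros Hd. destruct (pow_lt_1_zero (/ 2)) with (y := d) as [n0 Hn]; auto.
  - rewrite Rabs_right; lra.
  - exists n0. intros n Hle. specialize (Hn n Hle). rewrite Rabs_right in Hn; auto.
    apply Rle_ge. left. apply pow_lt. lra.
Qed.

(** The candidate X follows M with the gap F - M frozen from level m on. Rounding X to a finer grid
    may alter values up to level m; undoing that change costs at most 2^-m', which is less than the
    gap for large m'. *)
Lemma condition_raise m F M m1 : condition m F M ->
  exists m' F', (m1 <= m')%nat /\ condition m' F' M /\ extends m F M m' F' M.
Proof.
  intros (HF & HFs & HFg & HM & HMb & Hlt).
  destruct (level_gap m (fun rho => F rho - M rho)) as (d & Hd & Hgap).
  { intros rho Hr. specialize (Hlt rho Hr). lra. }
  destruct (half_pow_small d Hd) as [n0 Hn0].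
  set (m' := (n0 + m + m1)%nat). specialize (Hn0 m' ltac:(lia)).
  pose proof (martingale_lt_level M F m (proj2 HM) (proj2 HF) Hlt) as Hle.
  set (X := fun rho => M rho + (F (firstn m rho) - M (firstn m rho))).
  assert (HX : martingale X).
  { split; intros rho; unfold X.
    - pose proof (proj1 HM rho). pose proof (Hle (firstn m rho) (firstn_le_length _ _)). lra.
    - pose proof (proj2 HM rho). pose proof (proj2 (martingale_stop m M HM) rho).
      pose proof (proj2 (martingale_stop m F HF) rho). simpl in *. lra. }
  destruct (dyadic_approx X m' HX) as (G & HG & HGs & HGg & HGb).
  set (F' := fun rho => G rho + (F (firstn m rho) - G (firstn m rho))).
  assert (Hmm : forall rho : list bool, firstn m (firstn m' rho) = firstn m rho).
  { intros rho. rewrite firstn_firstn. f_equal. lia. }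
  assert (HF's : step_fun m' F').
  { intros rho. unfold F'. rewrite Hmm, HGs. auto. }
  assert (HF'e : forall rho, 2 * F' rho = F' (rho ++ [false]) + F' (rho ++ [true])).
  { intros rho. unfold F'. pose proof (proj2 HG rho).
    pose proof (proj2 (martingale_stop m G HG) rho).
    pose proof (proj2 (martingale_stop m F HF) rho). simpl in *. lra. }
  assert (HF'l : forall rho, length rho = m' -> M rho < F' rho).
  { intros rho Hr. unfold F'. pose proof (HGb rho ltac:(lia)) as A.
    assert (length (firstn m rho) = m) as Hlm by (rewrite length_firstn; lia).
    pose proof (HGb (firstn m rho) ltac:(lia)) as A'. pose proof (Hgap (firstn m rho) Hlm).
    unfold X in A, A'. rewrite firstn_firstn, Nat.min_id in A'. lra. }
  exists m', F'. split; [lia|]. split.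
  - split; [split; auto|].
    + intros rho. rewrite <- HF's. left. eapply Rle_lt_trans; [apply (proj1 HM)|].
      apply (martingale_lt_level M F' m' (proj2 HM) HF'e HF'l). apply firstn_le_length.
    + split; auto. split; auto. intros rho. unfold F'.
      destruct (HGg rho) as [z1 E1]. destruct (HGg (firstn m rho)) as [z2 E2].
      destruct (HFg (firstn m rho)) as [z3 E3].
      exists (z1 + (z3 * 4 ^ Z.of_nat (m' - m) - z2))%Z.
      rewrite plus_IZR, minus_IZR, mult_IZR, <- pow_IZR, <- E1, <- E2, <- E3.
      replace (4 ^ m') with (4 ^ m * 4 ^ (m' - m)) by (rewrite <- pow_add; f_equal; lia). ring.
  - split; [lia|]. split; [|intros; lra].
    intros rho Hr. unfold F'. rewrite firstn_all2 by auto. lra.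
Qed.

(** A martingale with initial value below d / 2^m stays below d on level m, so it fits into the gap
    of size d between M and F there. *)
Lemma condition_add_small (Sbar : nat -> list bool -> R) m F M N :
  (forall n, martingale (Sbar n) /\ bounded_fun (Sbar n)) -> Un_cv (fun n => Sbar n nil) 0 ->
  condition m F M ->
  exists n M', (N <= n)%nat /\ condition m F M' /\ extends m F M m F M' /\
    forall rho, Sbar n rho <= M' rho.
Proof.
  intros HS Hlim (HF & HFs & HFg & HM & HMb & Hlt).
  destruct (level_gap m (fun rho => F rho - M rho)) as (d & Hd & Hgap).
  { intros rho Hr. specialize (Hlt rho Hr). lra. }
  pose proof (pow_lt 2 m ltac:(lra)) as H2.
  destruct (Hlim (d / 2 ^ m)) as [n0 Hn0]; [apply Rdiv_lt_0_compat; auto|].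
  set (n := (n0 + N)%nat). specialize (Hn0 n ltac:(lia)). unfold Rdist in Hn0.
  destruct (HS n) as [HSm HSb]. rewrite Rminus_0_r, Rabs_right in Hn0 by apply Rle_ge, HSm.
  exists n, (fun rho => M rho + Sbar n rho). split; [lia|]. split; [|split].
  - do 3 (split; auto). split; [apply martingale_plus; auto|]. split; [apply bounded_plus; auto|].
    intros rho Hr. specialize (Hgap rho Hr).
    pose proof (martingale_growth (Sbar n) rho HSm) as Hg. rewrite Hr in Hg.
    apply Rmult_lt_compat_r with (r := 2 ^ m) in Hn0; auto.
    unfold Rdiv in Hn0. rewrite Rmult_assoc, Rinv_l in Hn0 by lra. lra.
  - split; [auto|split; auto]. intros rho. pose proof (proj1 HSm rho). lra.
  - intros rho. pose proof (proj1 HM rho). lra.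
Qed.

(** What a condition may assume of the martingale built at the end. The grid clause at arbitrarily
    high levels m1 lets an initial part of S have the exact form of a witness in [forcing]. *)
Definition limit_of (m : nat) (F M S : list bool -> R) : Prop :=
  martingale S /\ (forall rho, (length rho <= m)%nat -> S rho = F rho) /\
  forall k, exists m1, (k <= m1)%nat /\
    (forall rho, (length rho <= m1)%nat -> exists z, S rho * 4 ^ m1 = INR z) /\
    (forall rho, length rho = m1 -> M rho < S rho).

(** Decodes a witness into a condition. The strict bound on H makes M < F' strict on level m', and
    the partial oracle of the witness answers correctly for every S that agrees with F' up to that
    level, so p outputs i on all of them. *)
Lemma forcing_condition p m F M g G H t n i N phi gamma c b m' s :
  condition m F M ->
  (forall rho, INR (phi (encode_str rho)) = F rho * 4 ^ m) ->
  (forall rho, INR (gamma (encode_str rho)) = G rho * 4 ^ g) ->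
  (forall rho, M rho <= G rho + H rho) ->
  (forall rho, H rho < INR (N (encode_str rho)) / 4 ^ (length rho + t)) ->
  forcing p m phi g gamma t n i N c b m' s ->
  exists F', condition m' F' M /\ extends m F M m' F' M /\
    forall S, (forall rho, (length rho <= m')%nat -> S rho = F' rho) -> eval (oracle_of S) p [n] i.
Proof.
  intros (HF & HFs & HFg & HM & HMb & Hlt) Hphi Hgamma HGH HN (Hm & Hext & Hmart & Hdom & Hev).
  pose proof (pow4_pos m') as Pm'. pose proof (pow4_pos m) as Pm.
  pose proof (pow4_pos g) as Pg. pose proof (pow4_pos t) as Pt.
  set (F' := fun rho => INR (digit c b (encode_str (firstn m' rho))) / 4 ^ m').
  assert (HF'g : forall rho, F' rho * 4 ^ m' = INR (digit c b (encode_str (firstn m' rho)))).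
  { intros rho. unfold F'. field. lra. }
  exists F'. split; [|split].
  - split; [split|split; [|split; [|split; [|split]]]]; auto.
    + intros rho. apply Rmult_le_pos; [apply pos_INR|]. left. apply Rinv_0_lt_compat; auto.
    + intros rho. apply Rmult_eq_reg_r with (4 ^ m'); [|lra].
      rewrite Rmult_plus_distr_r, Rmult_assoc, !HF'g.
      destruct (Nat.lt_ge_cases (length rho) m') as [Hl|Hl].
      * destruct (firstn_snoc_lt m' rho false Hl) as [-> ->].
        destruct (firstn_snoc_lt m' rho true Hl) as [_ ->].
        destruct (encode_bounds rho) as [Hb1 Hb2].
        specialize (Hmart (length rho) Hl _ Hb2 Hb1). rewrite !encode_snoc, <- plus_INR, <- Hmart.
        rewrite mult_INR. auto.
      * rewrite !firstn_snoc_ge by auto. lra.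
    + intros rho. unfold F'. rewrite firstn_firstn, Nat.min_id. auto.
    + intros rho. eexists. rewrite HF'g, INR_IZR_INZ. reflexivity.
    + intros rho Hr. apply Rle_lt_trans with (1 := HGH rho).
      specialize (HN rho). unfold F'. rewrite firstn_all2 by lia.
      destruct (encode_bounds rho) as [Hb1 Hb2]. rewrite Hr in *.
      specialize (Hdom _ Hb2 Hb1). apply le_INR in Hdom.
      rewrite plus_INR, !mult_INR, !INR_pow4, Hgamma, !pow_add in Hdom.
      rewrite pow_add in HN. set (x := INR (N (encode_str rho))) in *.
      set (y := INR (digit c b (encode_str rho))) in *.
      apply Rlt_le_trans with (G rho + x / (4 ^ m' * 4 ^ t)); [lra|].
      apply Rmult_le_reg_r with (4 ^ m' * 4 ^ t * 4 ^ g); [repeat apply Rmult_lt_0_compat; auto|].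
      replace ((G rho + x / (4 ^ m' * 4 ^ t)) * (4 ^ m' * 4 ^ t * 4 ^ g)) with
        (4 ^ m' * 4 ^ t * (G rho * 4 ^ g) + 4 ^ g * x) by (field; lra).
      replace (y / 4 ^ m' * (4 ^ m' * 4 ^ t * 4 ^ g)) with (4 ^ g * 4 ^ t * y) by (field; lra).
      auto.
  - split; auto. split; [|intros; lra]. intros rho Hr. unfold F'. rewrite firstn_all2 by lia.
    specialize (Hext _ (code_bound m rho Hr)). apply (f_equal INR) in Hext.
    rewrite !mult_INR, !INR_pow4, Hphi in Hext.
    apply Rmult_eq_reg_r with (4 ^ m' * 4 ^ m); [|apply Rgt_not_eq, Rmult_lt_0_compat; auto].
    unfold Rdiv. rewrite <- Rmult_assoc, (Rmult_assoc _ (/ _)), Rinv_l by lra. lra.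
  - intros S HS. apply (ev_sound (partial_oracle c b m')) with (s := s); auto.
    intros a j v. unfold partial_oracle. destruct (Nat.ltb_spec a (2 ^ Datatypes.S m' - 1)) as [Ha|];
      [|discriminate]. intros [= <-].
    apply oracle_of_grid. pose proof (code_length m' a Ha) as Hl.
    rewrite HS, HF'g, firstn_all2, encode_decode; auto.
Qed.

(** An initial part of S is itself a witness: on some level m1 beyond all strings queried, S lies on
    the grid and above M, hence above G plus the supermartingale coded by N. For an N that is never
    forced, p therefore cannot output i. *)
Lemma limit_forced p m F M g G t n i N phi gamma S :
  (forall rho, INR (phi (encode_str rho)) = F rho * 4 ^ m) ->
  (forall rho, INR (gamma (encode_str rho)) = G rho * 4 ^ g) ->
  (forall rho, G rho + INR (N (encode_str rho)) / 4 ^ (length rho + t) <= M rho) ->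
  limit_of m F M S -> eval (oracle_of S) p [n] i ->
  exists u, forced p m phi g gamma t n i N u.
Proof.
  intros Hphi Hgamma HGN (HS & HSF & HSlim) Hev.
  destruct (ev_complete _ _ _ _ Hev) as [u0 Hu0].
  destruct (HSlim (m + u0)%nat) as (m1 & Hm1 & Hgrid & HM1).
  assert (forall rho, exists z, (length rho <= m1)%nat -> S rho * 4 ^ m1 = INR z) as Hz.
  { intros rho. destruct (Nat.le_gt_cases (length rho) m1) as [Hl|Hl]; [|exists 0%nat; lia].
    destruct (Hgrid rho Hl) as [z Ez]. eauto. }
  destruct (choice _ Hz) as [z Ez].
  set (L := (2 ^ Datatypes.S m1 - 1)%nat).
  assert (exists b, forall a, (a < L)%nat -> (z (decode_str a) <= b)%nat) as [b Hb].
  { clear. induction L as [|L [b IH]]; [exists 0%nat; lia|].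
    exists (b + z (decode_str L))%nat. intros a Ha.
    destruct (Nat.eq_dec a L) as [->|]; [lia|]. specialize (IH a ltac:(lia)). lia. }
  destruct (digit_surj b L _ Hb) as (c & _ & Hd).
  assert (Hdig : forall rho, (length rho <= m1)%nat ->
    INR (digit c b (encode_str rho)) = S rho * 4 ^ m1).
  { intros rho Hl. rewrite Hd by (apply code_bound; auto). rewrite decode_encode. symmetry. auto. }
  pose proof (pow4_pos m1) as Pm1. pose proof (pow4_pos m) as Pm.
  pose proof (pow4_pos g) as Pg. pose proof (pow4_pos t) as Pt.
  exists (Datatypes.S (c + b + m1 + u0)).
  exists c; split; [lia|]. exists b; split; [lia|]. exists m1; split; [lia|]. exists u0; split; [lia|].
  split; [lia|]. split; [|split; [|split]].
  - intros a Ha. pose proof (code_length m a Ha) as Hl. rewrite <- (encode_decode a).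
    apply INR_eq. rewrite !mult_INR, !INR_pow4, Hphi, Hdig, HSF by lia. ring.
  - intros l Hl a Ha Ha'. destruct (code_level l a Ha Ha') as (rho & <- & <-).
    rewrite <- (encode_snoc rho false), <- (encode_snoc rho true).
    apply INR_eq. rewrite plus_INR, mult_INR, !Hdig by (rewrite ?length_app; simpl; lia).
    pose proof (proj2 HS rho) as E. change (INR 2) with 2.
    rewrite <- Rmult_assoc, E. ring.
  - intros a Ha Ha'. destruct (code_level m1 a Ha Ha') as (rho & Hl & <-).
    apply INR_le. rewrite plus_INR, !mult_INR, !INR_pow4, Hgamma, Hdig, !pow_add by lia.
    specialize (HM1 rho Hl). specialize (HGN rho). rewrite Hl, pow_add in HGN.
    set (x := INR (N (encode_str rho))) in *.
    assert (E : G rho + x / (4 ^ m1 * 4 ^ t) <= S rho) by lra.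
    apply Rmult_le_compat_r with (r := 4 ^ m1 * 4 ^ t * 4 ^ g) in E;
      [|left; repeat apply Rmult_lt_0_compat; auto].
    replace ((G rho + x / (4 ^ m1 * 4 ^ t)) * (4 ^ m1 * 4 ^ t * 4 ^ g)) with
      (4 ^ m1 * 4 ^ t * (G rho * 4 ^ g) + 4 ^ g * x) in E by (field; lra).
    lra.
  - apply Hu0; auto. intros a j Ha. unfold partial_oracle.
    pose proof (code_length_le a) as Hl.
    pose proof (code_bound m1 (decode_str a) ltac:(lia)) as Hcb. rewrite encode_decode in Hcb.
    destruct (Nat.ltb_spec a (2 ^ Datatypes.S m1 - 1)); [|lia]. f_equal. symmetry.
    apply oracle_of_grid. rewrite <- Hdig, encode_decode by lia. auto.
Qed.

(** * Defeating one program *)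

Lemma condition_decide p (B : nat -> bool -> Prop) m F M :
  condition m F M ->
  ~ (exists X, (forall n, B n (X n)) /\ computable X) ->
  exists m' F' M', condition m' F' M' /\ extends m F M m' F' M' /\
    forall S X, limit_of m' F' M' S -> (forall n, B n (X n)) ->
      ~ forall n, eval (oracle_of S) p [n] (if X n then 1 else 0)%nat.
Proof.
  intros Hcond Hnc. pose proof Hcond as (HF & HFs & HFg & HM & HMb & Hlt).
  destruct (level_gap m (fun rho => F rho - M rho)) as (d & Hd & Hgap).
  { intros rho Hr. specialize (Hlt rho Hr). lra. }
  pose proof (pow_lt 2 m ltac:(lra)) as H2.
  (* Half of the gap d is reserved for the small martingales, whose initial values add up to at most
     7 / 4^t: 1 / 4^t from H and 3 / 4^t from each of the two counterexamples. Level m costs a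
     factor 2^m, whence 14 * 2^m. The other half of d absorbs the rounding error 2^-g of G. *)
  destruct (half_pow_small (d / (14 * 2 ^ m))) as [t Ht]; [apply Rdiv_lt_0_compat; lra|].
  specialize (Ht t (le_n t)).
  destruct (half_pow_small (d / 2)) as [m0 Hm0]; [lra|].
  pose proof (pow4_pos t) as Pt.
  assert (Hsmall : 2 ^ m * (7 / 4 ^ t) < d / 2).
  { assert (/ 4 ^ t <= (/ 2) ^ t) as E.
    { rewrite <- pow_inv. apply pow_incr. lra. }
    apply Rle_lt_trans with (2 ^ m * 7 * (/ 2) ^ t).
    - unfold Rdiv. rewrite <- Rmult_assoc. apply Rmult_le_compat_l; lra.
    - apply Rmult_lt_compat_l with (r := 2 ^ m * 7) in Ht; [|lra].
      replace (2 ^ m * 7 * (d / (14 * 2 ^ m))) with (d / 2) in Ht by (field; lra). auto. }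
  destruct (bounded_decomposition M (/ 4 ^ t) (m0 + m) HM HMb) as
    (g & G & H & Hg & HG & HGs & HGg & HGb & HH & HHb & HHt & HMGH); [apply Rinv_0_lt_compat; auto|].
  specialize (Hm0 g ltac:(lia)).
  destruct (martingale_grid H t HH HHb) as (N & C & HC & HNv & HNH).
  { apply Rmult_le_compat_r with (r := 4 ^ t) in HHt; [|lra]. rewrite Rinv_l in HHt; lra. }
  destruct (grid_nat m F HF HFg HFs) as (f & Hf & Hfs).
  destruct (grid_nat g G HG HGg HGs) as (f' & Hf' & Hfs').
  set (phi := fun a => f (decode_str a)). set (gamma := fun a => f' (decode_str a)).
  assert (Hphi : forall rho, INR (phi (encode_str rho)) = F rho * 4 ^ m).
  { intros. unfold phi. rewrite decode_encode. auto. }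
  assert (Hgamma : forall rho, INR (gamma (encode_str rho)) = G rho * 4 ^ g).
  { intros. unfold gamma. rewrite decode_encode. auto. }
  set (cov := fun n i => exists u, covered p m phi g gamma t C n i u).
  destruct (classic (exists n (x : bool), cov n (if x then 1 else 0)%nat /\ ~ B n x))
    as [(n & x & [u Hu] & HB)|HA].
  { apply covered_grid with (N := N) in Hu; auto.
    destruct Hu as (c & _ & b & _ & m' & _ & s & _ & Hforc).
    destruct (forcing_condition p m F M g G H t n _ N phi gamma c b m' s Hcond Hphi Hgamma HMGH HNH Hforc)
      as (F' & Hc & He & HS).
    exists m', F', M. split; auto. split; auto.
    intros S X (_ & HSF & _) HX Hev. apply HB.
    pose proof (eval_functional _ _ _ _ _ (HS S HSF) (Hev n)) as E.
    specialize (HX n). destruct x, (X n); try discriminate; auto. }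
  destruct (classic (exists n, ~ cov n 0%nat /\ ~ cov n 1%nat)) as [(n & Hn0 & Hn1)|HB].
  { destruct (uncovered_grid p m phi g gamma t C n 0) as [N0 HN0].
    { intros u Hu. apply Hn0. exists u. auto. }
    destruct (uncovered_grid p m phi g gamma t C n 1) as [N1 HN1].
    { intros u Hu. apply Hn1. exists u. auto. }
    destruct (grid_martingale N0 t C) as (H0 & HH0 & HH0b & HH0t & HH0N); auto; [apply HN0|].
    destruct (grid_martingale N1 t C) as (H1 & HH1 & HH1b & HH1t & HH1N); auto; [apply HN1|].
    set (M' := fun rho => (G rho + H rho) + (H0 rho + H1 rho)).
    exists m, F, M'. split; [|split].
    - do 3 (split; auto). split; [repeat apply martingale_plus; auto|]. split.
      + repeat apply bounded_plus; auto.
        destruct HMb as [K HK]. exists (K + (/ 2) ^ g). intros rho.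
        rewrite Rabs_right by apply Rle_ge, HG. rewrite <- HGs.
        specialize (HK (firstn g rho)). pose proof (Rle_abs (M (firstn g rho))).
        specialize (HGb (firstn g rho) (firstn_le_length _ _)). lra.
      + intros rho Hr. unfold M'. specialize (Hgap rho Hr). specialize (HGb rho ltac:(lia)).
        pose proof (martingale_growth H rho HH) as E. pose proof (martingale_growth H0 rho HH0) as E0.
        pose proof (martingale_growth H1 rho HH1) as E1. rewrite Hr in E, E0, E1.
        rewrite HH0t in E0. rewrite HH1t in E1.
        apply Rmult_le_compat_l with (r := 2 ^ m) in HHt; [|lra].
        unfold Rdiv in *. lra.
    - split; auto. split; auto. intros rho. unfold M'.
      pose proof (HMGH rho). pose proof (proj1 HH0 rho). pose proof (proj1 HH1 rho). lra.
    (* Whichever bit X has at n, S stays above G plus the counterexample for that bit, so an output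
       of this bit would make the counterexample forced. *)
    - intros S X HS HX Hev. specialize (Hev n).
      assert (forall rho, 0 <= H rho /\ 0 <= H0 rho /\ 0 <= H1 rho) as Hpos.
      { intros rho. split; [apply HH|split; [apply HH0|apply HH1]]. }
      destruct (X n).
      + destruct (limit_forced p m F M' g G t n 1 N1 phi gamma S) as [u Hu]; auto.
        * intros rho. specialize (HH1N rho). specialize (Hpos rho). unfold M'. lra.
        * apply (HN1 u). auto.
      + destruct (limit_forced p m F M' g G t n 0 N0 phi gamma S) as [u Hu]; auto.
        * intros rho. specialize (HH0N rho). specialize (Hpos rho). unfold M'. lra.
        * apply (HN0 u). auto. }
  (* In the remaining case every n has a covered bit by [HB] and every covered bit is allowed by
     [HA], so the computable selection is allowed at every position. *)
  exfalso. apply Hnc.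
  destruct (computable_selection p m phi g gamma t C) as (X & HX & HXc).
  - apply recursive_step with (l := m). auto.
  - apply recursive_step with (l := g). auto.
  - intros n. apply NNPP. intros Hn. apply HB. exists n.
    split; intros [u Hu]; apply Hn; [exists 0%nat, u|exists 1%nat, u]; auto.
  - exists X. split; auto. intros n. apply NNPP. intros HBn. apply HA. exists n, (X n). split; auto.
    apply HXc.
Qed.

(** * Construction of S from a sequence of conditions *)

Theorem theorem3p1
  (Sbar : nat -> list bool -> R)
  (T : list bool -> Prop)
  (HSbar : forall n, martingale (Sbar n) /\ bounded_fun (Sbar n))
  (Hlim : Un_cv (fun n => Sbar n nil) 0)
  (HT : homogeneous T)
  (HTnc : ~ (exists X : nat -> bool, is_path T X /\ computable X)) :
  exists S : list bool -> R,
    martingale S /\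
    (forall N : nat, exists n : nat, (N <= n)%nat /\ forall rho, Sbar n rho <= S rho) /\
    ~ computes_path_from S T.
Proof.
  destruct HT as [B HB].
  assert (Hpath : forall X, is_path T X <-> forall n, B n (X n)).
  { assert (Hnth : forall X n k, (k < n)%nat -> nth k (prefix X n) false = X k).
    { intros X n k Hk. unfold prefix.
      rewrite nth_indep with (d' := X 0%nat) by (rewrite length_map, length_seq; lia).
      rewrite map_nth, seq_nth; auto. }
    assert (Hlen : forall X n, length (prefix X n) = n).
    { intros. unfold prefix. rewrite length_map, length_seq. auto. }
    intros X. split.
    - intros HX n. specialize (HX (S n)). rewrite HB in HX. specialize (HX n).
      rewrite Hnth, Hlen in HX by lia. apply HX. lia.
    - intros HX n. apply HB. intros k Hk. rewrite Hlen in Hk. rewrite Hnth; auto. }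
  assert (Hnc : ~ exists X, (forall n, B n (X n)) /\ computable X).
  { intros (X & HX & HXc). apply HTnc. exists X. split; auto. apply Hpath; auto. }
  destruct prog_countable as [enum Henum].
  set (state := (nat * (list bool -> R) * (list bool -> R))%type).
  set (cond := fun st : state => let '(m, F, M) := st in condition m F M).
  set (ext := fun st st' : state =>
    let '(m, F, M) := st in let '(m', F', M') := st' in extends m F M m' F' M').
  set (lim := fun (st : state) S => let '(m, F, M) := st in limit_of m F M S).
  (* Stage k brings the level to at least k, adds a martingale of index at least k, and defeats the
     program with number k. *)
  assert (Hstep : forall kst : nat * state, exists st', cond (snd kst) ->
    cond st' /\ ext (snd kst) st' /\ (fst kst <= fst (fst st'))%nat /\
    (exists n, (fst kst <= n)%nat /\ forall rho, Sbar n rho <= snd st' rho) /\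
    forall S X, lim st' S -> (forall n, B n (X n)) ->
      ~ forall n, eval (oracle_of S) (enum (fst kst)) [n] (if X n then 1 else 0)%nat).
  { intros [k [[m F] M]]. simpl.
    destruct (classic (condition m F M)) as [Hc|Hc]; [|exists (0%nat, F, M); tauto].
    destruct (condition_raise m F M k Hc) as (m1 & F1 & Hm1 & Hc1 & He1).
    destruct (condition_add_small Sbar m1 F1 M k HSbar Hlim Hc1) as (n & M2 & Hn & Hc2 & He2 & HS2).
    destruct (condition_decide (enum k) B m1 F1 M2 Hc2 Hnc) as (m3 & F3 & M3 & Hc3 & He3 & Hdec).
    exists (m3, F3, M3). intros _. simpl. split; auto. split; [|split; [|split]]; auto.
    - eapply extends_trans; [|exact He3]. eapply extends_trans; eauto.
    - destruct He3 as [He3 _]. lia.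
    - exists n. split; auto. intros rho. destruct He3 as (_ & _ & He3).
      eapply Rle_trans; [apply HS2|apply He3]. }
  destruct (choice _ Hstep) as [next Hnext].
  set (st := nat_rect (fun _ => state) (0%nat, (fun _ => 1), (fun _ => 0)) (fun k s => next (k, s))).
  assert (Hcond : forall k, cond (st k)).
  { induction k; [|apply (Hnext (k, st k)); auto]. simpl. unfold condition.
    split; [split; intros; lra|]. split; [intros rho; auto|]. split; [exists 1%Z; simpl; lra|].
    split; [split; intros; lra|]. split; [|intros; lra].
    exists 0. intros. rewrite Rabs_R0. lra. }
  assert (Hext : forall j k, (j <= k)%nat -> ext (st j) (st k)).
  { intros j k. induction 1 as [|k _ IH].
    - destruct (st j) as [[m F] M]. apply extends_refl.
    - destruct (Hnext (k, st k) (Hcond k)) as (_ & He & _). simpl in He.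
      change (st (S k)) with (next (k, st k)).
      destruct (st j) as [[m F] M], (st k) as [[m1 F1] M1], (next _) as [[m2 F2] M2].
      eapply extends_trans; eauto. }
  set (mm := fun k => fst (fst (st k))). set (FF := fun k => snd (fst (st k))).
  set (MM := fun k => snd (st k)).
  assert (Hst : forall k, st k = (mm k, FF k, MM k)).
  { intros k. unfold mm, FF, MM. destruct (st k) as [[? ?] ?]. auto. }
  assert (Hcond' : forall k, condition (mm k) (FF k) (MM k)).
  { intros k. specialize (Hcond k). rewrite Hst in Hcond. auto. }
  assert (Hext' : forall j k, (j <= k)%nat -> extends (mm j) (FF j) (MM j) (mm k) (FF k) (MM k)).
  { intros j k Hjk. specialize (Hext j k Hjk). rewrite !Hst in Hext. auto. }
  assert (Hmm : forall k, (k <= mm (S k))%nat).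
  { intros k. apply (Hnext (k, st k) (Hcond k)). }
  assert (Hlow : forall k rho, (length rho <= mm k)%nat -> MM k rho < FF k rho).
  { intros k rho. destruct (Hcond' k) as (HF & _ & _ & HM & _ & Hlt).
    apply (martingale_lt_level _ _ _ (proj2 HM) (proj2 HF) Hlt). }
  (* Stage k produces [st (S k)], whose level is at least k; hence rho is settled at index
     [S (length rho)]. *)
  set (SS := fun rho : list bool => FF (S (length rho)) rho).
  assert (HSS : forall k rho, (length rho <= mm k)%nat -> SS rho = FF k rho).
  { intros k rho Hl. unfold SS. destruct (Nat.le_ge_cases k (S (length rho))) as [Hk|Hk].
    - apply (Hext' _ _ Hk). auto.
    - symmetry. apply (Hext' _ _ Hk). apply Hmm. }
  assert (HMS : forall k rho, MM k rho < SS rho).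
  { intros k rho. set (j := max k (S (length rho))).
    destruct (Hext' k j ltac:(lia)) as (_ & _ & H1).
    destruct (Hext' (S (length rho)) j ltac:(lia)) as (H2 & _). pose proof (Hmm (length rho)).
    rewrite (HSS j) by lia. eapply Rle_lt_trans; [apply H1|]. apply Hlow. lia. }
  assert (Hmart : martingale SS).
  { split.
    - intros rho. left. eapply Rle_lt_trans; [|apply (HMS 0%nat)]. apply Rle_refl.
    - intros rho. pose proof (Hmm (S (length rho))).
      rewrite !(HSS (S (S (length rho)))) by (rewrite ?length_app; simpl; lia).
      apply (Hcond' (S (S (length rho)))). }
  exists SS. split; [auto|split].
  - intros N. destruct (Hnext (N, st N) (Hcond N)) as (_ & _ & _ & (n & Hn & HS) & _).
    exists n. split; auto. intros rho. eapply Rle_trans; [apply HS|]. left. apply (HMS (S N)).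
  - intros (X & HX & p & Hp). destruct (Henum p) as [k <-].
    destruct (Hnext (k, st k) (Hcond k)) as (_ & _ & _ & _ & Hdec).
    apply (Hdec SS X); auto; [|apply Hpath; auto].
    change (next _) with (st (S k)). rewrite Hst. split; [auto|split].
    + intros rho Hl. apply HSS; auto.
    + intros k'. set (j := max (S k) (S k')).
      destruct (Hext' (S k') j ltac:(lia)) as (H2 & _). pose proof (Hmm k').
      exists (mm j). split; [lia|]. split.
      * intros rho Hl. destruct (Hcond' j) as (HF & HFs & HFg & _).
        destruct (grid_nat _ _ HF HFg HFs) as (f & Hf & _). exists (f rho).
        rewrite Hf, (HSS j); auto.
      * intros rho _. apply HMS.
Qed.
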